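(* Let $\gamma\in W^{2,2}_{\mathrm{Imm}}$ be a closed curve of winding number $n_\gamma=1$, parametrized by arc length, which is not a circle and which is a weak solution of $$-\kappa''-\tfrac12\kappa^3+1=0 .$$ Then $\kappa$ is periodic with number of periods $m\ge2$. Conversely, for each integer $m\ge2$ there is exactly one solution $\kappa$ (up to a shift of the arc-length parameter) of this equation with $m$ periods which corresponds to a closed curve $\gamma$ (with $n_\gamma=1$). Furthermore, the following hold: $$\mathcal E(\gamma)\ge\sqrt{\tfrac{11}{6}}\;m\pi,\qquad \mathcal A(\gamma)=\tfrac14\,\mathcal E(\gamma)\ge\sqrt{\tfrac{11}{96}}\;m\pi .$$
   Context: For an immersed closed curve $\gamma$ write $ds=|\partial_x\gamma|\,dx$, $\partial_s=\partial_x/|\partial_x\gamma|$, $\tau=\partial_s\gamma=(\tau_1,\tau_2)$, $\nu=(-\tau_2,\tau_1)$, $\kappa$ defined by $\partial_s\tau=\kappa\nu$; $\mathcal E(\gamma)=\int\kappa^2ds$, $\mathcal L(\gamma)=\int ds$, $\mathcal A(\gamma)=-\frac12\int\nu\cdot\gamma\,ds$ (algebraic area), $n_\gamma=\frac1{2\pi}\int\kappa\,ds$ (winding number). $W^{2,2}_{\mathrm{Imm}}$ denotes $W^{2,2}$ closed curves with nowhere vanishing derivative. An arc-length parametrized closed curve is viewed as a curve on $[0,\mathcal L(\gamma)]$ with identified endpoints, and $'$ is the derivative in arc length. The curvature $\kappa$ has $m$ periods if its minimal period is $\mathcal L(\gamma)/m$. Weak solutions of the equation are smooth. A function $\kappa$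 with $m$ periods (each of length $T$) corresponds to a closed curve if the arc-length curve with curvature $\kappa$ on $[0,mT]$ closes up smoothly. *)

(* Defs.v *)
From HB Require Import structures.
From mathcomp Require Import all_boot all_order all_algebra.
From mathcomp Require Import all_classical all_reals all_analysis.

Set Implicit Arguments.
Unset Strict Implicit.
Unset Printing Implicit Defensive.

Import Order.TTheory GRing.Theory Num.Theory.
Import numFieldNormedType.Exports.

Local Open Scope classical_set_scope.
Local Open Scope ring_scope.

Section PlaneCurves.
Context {R : realType}.

Local Notation leb := (@lebesgue_measure R).

Definition is_minimal_period (T : R) (f : R -> R) : Prop :=
  [/\ 0 < T, periodic f T & forall S, 0 < S -> periodic f S -> T <= S].

(* m periods on a circle of length P: the minimal period is P/m. *)
Definition has_m_periods (m : nat) (P : R) (f : R -> R) : Prop :=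
  is_minimal_period (P / m%:R) f.

Definition smooth (f : R -> R) : Prop :=
  forall (n : nat) (t : R), derivable (derive1n n f) t 1.

Definition L2 (P : R) (f : R -> R) : Prop :=
  measurable_fun `[0, P] f /\
  leb.-integrable `[0, P] (fun t => (f t ^+ 2)%:E).

(* g is the weak derivative of f on the circle R/PZ: the test functions are
   the smooth P-periodic functions. *)
Definition weak_derivative (P : R) (f g : R -> R) : Prop :=
  forall phi : R -> R, smooth phi -> periodic phi P ->
    \int[leb]_(t in `[0, P]) (f t * derive1 phi t) =
    - \int[leb]_(t in `[0, P]) (g t * phi t).

(* W^{2,2}(R/PZ). A W^{2,2} function is identified with its C^1
   representative, so its first derivative is the classical one. *)
Definition W22 (P : R) (f : R -> R) : Prop :=
  [/\ periodic f P,
      forall t, derivable f t 1,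
      continuous (derive1 f) &
      exists2 g : R -> R, L2 P g & weak_derivative P (derive1 f) g].

(* Plane curves are maps R -> R * R. The norm of the library on R * R is the
   sup norm, so the Euclidean structure is spelled out here, and curves are
   differentiated coordinatewise. *)
Definition dot (u v : R * R) : R := u.1 * v.1 + u.2 * v.2.
Definition enorm (u : R * R) : R := Num.sqrt (dot u u).

Definition dcurve (gamma : R -> R * R) (t : R) : R * R :=
  (derive1 (fun u => (gamma u).1) t, derive1 (fun u => (gamma u).2) t).

Definition speed (gamma : R -> R * R) (t : R) : R := enorm (dcurve gamma t).

(* d/ds = |d_x gamma|^{-1} d_x, acting on vector fields along gamma *)
Definition darc (gamma X : R -> R * R) (t : R) : R * R :=
  ((dcurve X t).1 / speed gamma t, (dcurve X t).2 / speed gamma t).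

Definition tangent (gamma : R -> R * R) : R -> R * R := darc gamma gamma.

Definition normal (gamma : R -> R * R) (t : R) : R * R :=
  (- (tangent gamma t).2, (tangent gamma t).1).

(* d_s tau = kappa nu and |nu| = 1 give kappa = <d_s tau, nu>. For a W^{2,2}
   curve, tau is absolutely continuous, so the classical derivative of tau
   exists almost everywhere and coincides with the weak one. *)
Definition curvature (gamma : R -> R * R) (t : R) : R :=
  dot (darc gamma (tangent gamma) t) (normal gamma t).

(* W^{2,2} closed curves, parametrized on R/PZ, with nowhere vanishing
   derivative *)
Definition W22Imm (P : R) (gamma : R -> R * R) : Prop :=
  [/\ 0 < P,
      W22 P (fun t => (gamma t).1),
      W22 P (fun t => (gamma t).2) &
      forall t, dcurve gamma t != (0, 0)].

Definition arclength (gamma : R -> R * R) : Prop :=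
  forall t, speed gamma t = 1.

(* the integral of f ds over one turn of the curve *)
Definition curve_integral (P : R) (gamma : R -> R * R) (f : R -> R) : R :=
  \int[leb]_(t in `[0, P]) (f t * speed gamma t).

Definition elastic_energy (P : R) (gamma : R -> R * R) : R :=
  curve_integral P gamma (fun t => curvature gamma t ^+ 2).

Definition curve_length (P : R) (gamma : R -> R * R) : R :=
  curve_integral P gamma (fun=> 1).

Definition algebraic_area (P : R) (gamma : R -> R * R) : R :=
  - 2^-1 * curve_integral P gamma (fun t => dot (normal gamma t) (gamma t)).

Definition winding_number (P : R) (gamma : R -> R * R) : R :=
  (2 * pi)^-1 * curve_integral P gamma (curvature gamma).

Definition is_circle (gamma : R -> R * R) : Prop :=
  exists (c : R * R) (r : R), 0 < r /\
    range gamma = [set p | enorm (p.1 - c.1, p.2 - c.2) = r].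

(* -kappa'' - kappa^3/2 + 1 = 0 in the sense of distributions on R/PZ.
   Integrability of kappa^3 is what gives the equation a meaning there. *)
Definition weak_solution (P : R) (kappa : R -> R) : Prop :=
  leb.-integrable `[0, P] (fun t => (kappa t ^+ 3)%:E) /\
  forall phi : R -> R, smooth phi -> periodic phi P ->
    \int[leb]_(t in `[0, P])
      (- (kappa t * derive1n 2 phi t) - 2^-1 * kappa t ^+ 3 * phi t + phi t)
    = 0.

Definition smooth_solution (kappa : R -> R) : Prop :=
  smooth kappa /\
  forall t, - derive1n 2 kappa t - 2^-1 * kappa t ^+ 3 + 1 = 0.

(* The arc-length curve with curvature kappa on [0,P] closes up smoothly, i.e.
   extends to a smooth P-periodic curve gamma. *)
Definition closed_curve_of_curvature (P : R) (kappa : R -> R)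
    (gamma : R -> R * R) : Prop :=
  [/\ smooth (fun t => (gamma t).1),
      smooth (fun t => (gamma t).2),
      periodic gamma P,
      arclength gamma &
      curvature gamma =1 kappa].

Definition solution_with_curve (m : nat) (P : R) (kappa : R -> R)
    (gamma : R -> R * R) : Prop :=
  [/\ smooth_solution kappa,
      has_m_periods m P kappa,
      closed_curve_of_curvature P kappa gamma &
      winding_number P gamma = 1].

Definition energy_area_bounds (m : nat) (P : R) (gamma : R -> R * R) : Prop :=
  [/\ Num.sqrt (11 / 6) * m%:R * pi <= elastic_energy P gamma,
      algebraic_area P gamma = 4^-1 * elastic_energy P gamma &
      Num.sqrt (11 / 96) * m%:R * pi <= 4^-1 * elastic_energy P gamma].

End PlaneCurves.

(* Main.v *)
(* The equation [k'' = 1 - k^3 / 2] has the first integral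
   [k'^2 + k^4 / 4 - 2 k], whose quartic has two real roots at the extreme
   values of a periodic solution. Factoring it and writing
   [k = (s / 2) (1 + e cos p)] gives all nonconstant periodic solutions, up to
   shifts, as a one-parameter family in [e > 0], with [p' > 0] explicit. The
   vector [gamma - (k' tau - k^2 / 2 nu)] is constant along a curve with
   curvature [k]; hence the curve closes up as soon as [k] is periodic with total
   curvature [2 pi], and the area is a quarter of the energy. A winding number 1
   curve with [m] periods turns by [2 pi / m] in each period. The turning angle
   of one period is strictly decreasing in [e], from [4 pi / sqrt 6], which lies
   between [pi] and [2 pi], to [0]: this excludes [m = 1] and gives exactly one
   [e] for each [m >= 2]. The energy bound holds for one period of every member
   of the family. *)
Require Import Defs.
From mathcomp Require Import all_boot all_order all_algebra.
From mathcomp Require Import all_classical all_reals all_analysis.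
From mathcomp Require Import measurable_realfun ring lra.

Set Implicit Arguments.
Unset Strict Implicit.
Unset Printing Implicit Defensive.

Import Order.TTheory GRing.Theory Num.Theory.
Import numFieldNormedType.Exports.

Local Open Scope classical_set_scope.
Local Open Scope ring_scope.

(** * Calculus on the line *)

Section Calculus.
Context {R : realType}.
Implicit Types (f g h F G : R -> R) (a b c t x y z P : R).

Local Notation mu := (@lebesgue_measure R).

(** The weak equation is only tested against smooth periodic functions, and [curvature] uses
    classical derivatives of the tangent that exist almost everywhere. Regularity is therefore
    proved for primitives, which are continuous: a du Bois-Reymond argument identifies primitives,
    Lebesgue differentiation returns to the functions almost everywhere, and continuity of the
    tangent then yields the Frenet equations, hence the value of the curvature, at every point.
    Solutions of the equation are produced by inverting an explicit integral, and uniqueness is a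
    Gronwall estimate, global because periodic solutions are bounded. Both elliptic integrals are
    controlled by explicit primitives. The derivative of the turning angle has an integrand of
    changing sign, which an exact derivative corrects. In the energy, the inverse square root is
    bounded below by a tangent, which leaves a trigonometric polynomial. *)

Lemma is_derive_cont f g : (forall x : R, is_derive x 1 f (g x)) -> continuous f.
Proof.
move=> fg x; have [fx _] := fg x.
exact/differentiable_continuous/derivable1_diffP.
Qed.

Lemma derivable_cont f : (forall x, derivable f x 1) -> continuous f.
Proof.
by move=> df x; have := df x => /derivable1_diffP/differentiable_continuous.
Qed.

Lemma is_derive_derivable f x a : is_derive x 1 f a -> derivable f x 1.
Proof. by case. Qed.

Lemma is_derive_derive1 f x a : is_derive x 1 f a -> derive1 f x = a.
Proof. by move=> fa; rewrite derive1E derive_val. Qed.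

Lemma derivable_is_derive f x : derivable f x 1 -> is_derive x 1 f (derive1 f x).
Proof. by move=> fx; apply: DeriveDef => //; rewrite derive1E. Qed.

Lemma is_derive1_eq f x a b : is_derive x 1 f a -> a = b -> is_derive x 1 f b.
Proof. by move=> ? <-. Qed.

Lemma deriveC x c : is_derive x 1 (fun=> c) 0.
Proof. exact: is_derive_cst. Qed.

Lemma deriveI x : is_derive x 1 (fun t : R => t) 1.
Proof. exact: is_derive_id. Qed.

Lemma deriveDf f g x a b : is_derive x 1 f a -> is_derive x 1 g b ->
  is_derive x 1 (fun t => f t + g t) (a + b).
Proof. by move=> ? ?; exact: is_deriveD. Qed.

Lemma deriveNf f x a : is_derive x 1 f a -> is_derive x 1 (fun t => - f t) (- a).
Proof. by move=> ?; exact: is_deriveN. Qed.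

Lemma deriveMf f g x a b : is_derive x 1 f a -> is_derive x 1 g b ->
  is_derive x 1 (fun t => f t * g t) (a * g x + f x * b).
Proof.
move=> fa gb; have := is_deriveM fa gb.
by rewrite /GRing.scale/= addrC (mulrC a).
Qed.

Lemma derive_mull c x : is_derive x 1 ( *%R c) c.
Proof.
have := deriveMf (deriveC x c) (deriveI x).
by rewrite mul0r add0r mulr1.
Qed.

Lemma derive_addl c x : is_derive x 1 (+%R c) 1.
Proof. by have := deriveDf (deriveC x c) (deriveI x); rewrite add0r. Qed.

Lemma deriveXf f n x a : is_derive x 1 f a ->
  is_derive x 1 (fun t => f t ^+ n) (n%:R * f x ^+ n.-1 * a).
Proof.
case: n => [|n] fa; first by rewrite !mul0r; exact: deriveC.
by have := is_deriveX n.+1 fa; rewrite exprfctE.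
Qed.

Lemma derive_compf f g x a b : is_derive (g x) 1 f a -> is_derive x 1 g b ->
  is_derive x 1 (fun t => f (g t)) (a * b).
Proof. by move=> ? ?; exact: is_derive1_comp. Qed.

Lemma derive_cosf g x b : is_derive x 1 g b ->
  is_derive x 1 (fun t => cos (g t)) (- sin (g x) * b).
Proof. by apply: derive_compf; exact: is_derive_cos. Qed.

Lemma derive_sinf g x b : is_derive x 1 g b ->
  is_derive x 1 (fun t => sin (g t)) (cos (g x) * b).
Proof. by apply: derive_compf; exact: is_derive_sin. Qed.

Lemma deriveVf g x b : g x != 0 -> is_derive x 1 g b ->
  is_derive x 1 (fun t => (g t)^-1) (- (g x) ^- 2 * b).
Proof. by move=> ? ?; exact: is_deriveV. Qed.

Lemma derive_sqrtf g x b : 0 < g x -> is_derive x 1 g b ->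
  is_derive x 1 (fun t => Num.sqrt (g t)) ((2 * Num.sqrt (g x))^-1 * b).
Proof. by move=> gx; apply: derive_compf; exact: is_derive1_sqrt. Qed.

End Calculus.

(* Differentiates a term built from functions with known derivatives; the goals
   left are the side conditions of inverses and square roots, then the equality
   of the computed derivative with the expected one. *)
Ltac derstep :=
  match goal with
  | H : forall x, is_derive x _ ?F _ |- is_derive _ _ (fun t => ?F t) _ => exact: H
  | H : forall x, is_derive x _ ?F _ |- is_derive _ _ ?F _ => exact: H
  | H : is_derive ?x _ ?F _ |- is_derive ?x _ (fun t => ?F t) _ => exact: H
  | H : is_derive ?x _ ?F _ |- is_derive ?x _ ?F _ => exact: H
  | |- is_derive _ _ (fun=> _) _ => apply: deriveC
  | |- is_derive _ _ (fun t => t) _ => apply: deriveI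
  | |- is_derive _ _ ( *%R _) _ => exact: derive_mull
  | |- is_derive _ _ (+%R _) _ => exact: derive_addl
  | |- is_derive _ _ -%R _ => exact: is_deriveNid
  | |- is_derive _ _ cos _ => exact: is_derive_cos
  | |- is_derive _ _ sin _ => exact: is_derive_sin
  | |- is_derive _ _ (fun t => _ + _) _ => eapply deriveDf; derstep
  | |- is_derive _ _ (fun t => - _) _ => eapply deriveNf; derstep
  | |- is_derive _ _ (fun t => _ * _) _ => eapply deriveMf; derstep
  | |- is_derive _ _ (fun t => _ ^+ _) _ => eapply deriveXf; derstep
  | |- is_derive _ _ (fun t => cos _) _ => eapply derive_cosf; derstep
  | |- is_derive _ _ (fun t => sin _) _ => eapply derive_sinf; derstep
  | |- is_derive _ _ (fun t => _^-1) _ => eapply deriveVf; [|derstep]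
  | |- is_derive _ _ (fun t => Num.sqrt _) _ => eapply derive_sqrtf; [|derstep]
  end.
Ltac der := eapply is_derive1_eq; [derstep|cbv beta].
Ltac dercont := apply: derivable_cont => ?; eapply is_derive_derivable; derstep.
Ltac dercomp dF := eapply is_derive1_eq;
  [eapply derive_compf; [exact: dF|derstep]|cbv beta].

Section CalculusTheorems.
Context {R : realType}.
Implicit Types (f g h F G : R -> R) (a b c t x y z P : R).

Local Notation mu := (@lebesgue_measure R).

Lemma cont_integrable f a b : continuous f -> mu.-integrable `[a, b] (EFin \o f).
Proof.
move=> cf; apply: continuous_compact_integrable; first exact: segment_compact.
exact: continuous_subspaceT.
Qed.

Lemma Rintegral_Chasles f a b c : mu.-integrable `[a, c] (EFin \o f) ->
  a <= b -> b <= c ->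
  \int[mu]_(t in `[a, c]) f t =
  \int[mu]_(t in `[a, b]) f t + \int[mu]_(t in `[b, c]) f t.
Proof.
move=> fi ab bc.
have := @Rintegral_itvB R f (BLeft a) (BRight c) b fi.
rewrite !bnd_simp ab bc => /(_ isT isT) H.
rewrite -(@Rintegral_itv_obnd_cbnd R b (BRight c)).
  by rewrite -H addrC subrK.
apply: integrableS fi => //; apply: subset_itvr; rewrite bnd_simp.
exact: ab.
Qed.

Lemma ex_primitive f : continuous f ->
  exists F, F 0 = 0 /\ forall x : R, is_derive x 1 F (f x).
Proof.
move=> cf.
pose G a x := \int[mu]_(t in `[a, x]) f t.
(* The base point depends on [x] so as to lie to the left of both [0] and [x]; near a given [x0] it
   can be replaced by the fixed [a], by additivity. *)
exists (fun x => G (- `|x| - 1) x - G (- `|x| - 1) 0); split.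
  by rewrite subrr.
move=> x0; pose a := - `|x0| - 2.
have Ga x : a < x -> is_derive x 1 (G a) (f x).
  move=> ax; have [] := @continuous_FTC1_closed R f a x (x + 1).
  - by rewrite ltrDl.
  - exact: cont_integrable.
  - exact: ax.
  - exact: cf.
  by move=> /derivable_is_derive + <-.
have ax0 : a < x0 by rewrite /a; have := ler_norm (- x0); rewrite normrN; lra.
apply: (@near_eq_is_derive _ _ _ (fun x => G a x - G a 0)); last first.
  have := Ga _ ax0 => ?.
  by apply: is_derive_eq; rewrite subr0.
near=> x.
have xx0 : `|x| < `|x0| + 1.
  rewrite -ltrBlDl; apply: le_lt_trans (lerB_dist x x0) _.
  near: x; exists 1 => //= y; by rewrite /= distrC.
have H1 : a <= - `|x| - 1 by rewrite /a; lra.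
have H2 : - `|x| - 1 <= x by have := ler_norm (- x); rewrite normrN; lra.
have H3 : - `|x| - 1 <= 0 by have := normr_ge0 x; lra.
rewrite /G (Rintegral_Chasles (cont_integrable _ _ cf) H1 H2).
rewrite (Rintegral_Chasles (cont_integrable _ _ cf) H1 H3).
ring.
Unshelve. all: by end_near. Qed.

Lemma Rintegral_FTC2 F f a b : a <= b -> continuous f ->
  (forall x : R, is_derive x 1 F (f x)) ->
  \int[mu]_(t in `[a, b]) f t = F b - F a.
Proof.
rewrite le_eqVlt => /predU1P[->|ab] cf dF.
  by rewrite set_itv1 Rintegral_set1 subrr.
have cF := is_derive_cont dF.
rewrite /Rintegral (@continuous_FTC2 R f F a b)//.
- exact: continuous_subspaceT.
- split.
  + by move=> x _; have [] := dF x.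
  + exact/cvg_at_right_filter/cF.
  + exact/cvg_at_left_filter/cF.
- by move=> x _; exact: is_derive_derive1.
Qed.

Lemma eq_is_derive_cst F G f : (forall x : R, is_derive x 1 F (f x)) ->
  (forall x : R, is_derive x 1 G (f x)) -> forall x y, F x - G x = F y - G y.
Proof.
move=> dF dG x y; apply: (@is_derive_0_is_cst _ (fun x => F x - G x)) => z.
by der; rewrite subrr.
Qed.

Lemma is_derive_mvt F f x y : x <= y -> (forall x : R, is_derive x 1 F (f x)) ->
  exists2 c, x <= c <= y & F y - F x = f c * (y - x).
Proof.
move=> xy dF; have [|c cxy ->] := @MVT_segment R F f _ _ xy.
  exact/continuous_subspaceT/(is_derive_cont dF).
by exists c => //; rewrite in_itv in cxy.
Qed.

Lemma is_derive_gt0_lt F f x y : (forall x : R, is_derive x 1 F (f x)) ->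
  (forall x, 0 < f x) -> x < y -> F x < F y.
Proof.
move=> dF f0 xy; have [c _ H] := is_derive_mvt (ltW xy) dF.
by rewrite -subr_gt0 H mulr_gt0// subr_gt0.
Qed.

Lemma is_derive_ge0_le F f x y : (forall x : R, is_derive x 1 F (f x)) ->
  (forall x, 0 <= f x) -> x <= y -> F x <= F y.
Proof.
move=> dF f0 xy; have [c _ H] := is_derive_mvt xy dF.
by rewrite -subr_ge0 H mulr_ge0// subr_ge0.
Qed.

Lemma primitive_periodic F f P : (forall x : R, is_derive x 1 F (f x)) ->
  periodic f P -> forall x, F (x + P) = F x + (F P - F 0).
Proof.
move=> dF fP x.
have dFP y : is_derive y 1 (fun y => F (y + P)) (f y).
  by dercomp dF; rewrite fP; ring.
have := eq_is_derive_cst dFP dF x 0; rewrite add0r; lra.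
Qed.

End CalculusTheorems.

(** * The turning angle of one period *)

Section Profile.
Context {R : realType}.
Implicit Types (e p x y z : R).

Local Notation mu := (@lebesgue_measure R).

(* With kappa = (s/2) (1 + e cos p), the energy integral factors as
   kappa'^2 = (kappa_max - kappa) (kappa - kappa_min) (s^2/16) (quart e p),
   so that p' = (s/4) sqrt (quart e p) and kappa ds = 2 (turn e p) dp. *)
Definition quart e p : R := 6 + 4 * (e * cos p) + e ^+ 2 + (e * cos p) ^+ 2.

Definition turn e p : R := (1 + e * cos p) / Num.sqrt (quart e p).

Definition turning_angle e : R := 2 * \int[mu]_(p in `[0, 2 * pi]) turn e p.

(** Completing the square: [quart e p = 2 + e^2 + (e cos p + 2)^2]. *)
Lemma quart_ge e p : 2 + e ^+ 2 <= quart e p.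
Proof. by rewrite /quart; have := sqr_ge0 (e * cos p + 2); nra. Qed.

Lemma quart_gt0 e p : 0 < quart e p.
Proof. by apply: lt_le_trans (quart_ge e p); have := sqr_ge0 e; lra. Qed.

Lemma sqrt_quart_gt0 e p : 0 < Num.sqrt (quart e p).
Proof. by rewrite sqrtr_gt0 quart_gt0. Qed.

Lemma sqrt_quart_neq0 e p : Num.sqrt (quart e p) != 0.
Proof. by rewrite gt_eqF// sqrt_quart_gt0. Qed.

Lemma sqr_sqrt_quart e p : Num.sqrt (quart e p) ^+ 2 = quart e p.
Proof. by rewrite sqr_sqrtr// ltW// quart_gt0. Qed.

Lemma is_derive_quart e p :
  is_derive p 1 (quart e) (- (e * sin p) * (4 + 2 * (e * cos p))).
Proof. by rewrite /quart; der; ring. Qed.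

Lemma is_derive_quart1 e p : is_derive e 1 (quart ^~ p)
  (4 * cos p + 2 * e + 2 * e * cos p ^+ 2).
Proof. by rewrite /quart; der; rewrite ?expr1; ring. Qed.

Lemma is_derive_sqrt_quart e p : is_derive p 1 (fun p => Num.sqrt (quart e p))
  ((2 * Num.sqrt (quart e p))^-1 * (- (e * sin p) * (4 + 2 * (e * cos p)))).
Proof. by apply: derive_sqrtf; [exact: quart_gt0|exact: is_derive_quart]. Qed.

Lemma continuous_turn e : continuous (turn e).
Proof.
have dq := is_derive_sqrt_quart e.
rewrite /turn; dercont.
exact: sqrt_quart_neq0.
Qed.

Definition dturn e p : R :=
  (4 * cos p - e * sin p ^+ 2) / Num.sqrt (quart e p) ^+ 3.

Lemma is_derive_turn1 e p : is_derive e 1 (turn ^~ p) (dturn e p).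
Proof.
rewrite /turn /dturn.
have dq := @derive_sqrtf _ (quart^~ p) e _ (quart_gt0 e p) (is_derive_quart1 e p).
have q0 := sqrt_quart_neq0 e p; have q2 := sqr_sqrt_quart e p.
have s2 := sin2cos2 p.
der => //; move: (Num.sqrt (quart e p)) q0 q2 => q q0 q2.
transitivity ((cos p * q ^+ 2 - (1 + e * cos p) *
  (4 * cos p + 2 * e + 2 * e * cos p ^+ 2) / 2) / q ^+ 3); first by field.
by rewrite q2 /quart s2; congr (_ / _); field.
Qed.

Lemma continuous_dturn e : continuous (dturn e).
Proof.
have dq := is_derive_sqrt_quart e.
rewrite /dturn; dercont.
by rewrite expf_neq0// sqrt_quart_neq0.
Qed.

Lemma dturn_bound x p : `|dturn x p| <= 4 + `|x|.
Proof.
rewrite /dturn normf_div ler_pdivrMr; last first.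
  by rewrite normr_gt0 expf_neq0// sqrt_quart_neq0.
have q1 : 1 <= Num.sqrt (quart x p) ^+ 3.
  apply: exprn_ege1; rewrite -(sqrtr1 R); apply: ler_wsqrtr.
  by apply: le_trans (quart_ge x p); have := sqr_ge0 x; lra.
apply: (@le_trans _ _ (4 + `|x|)).
  apply: (le_trans (ler_normB _ _)); apply: lerD; rewrite normrM.
    by rewrite ger0_norm// ler_piMr// cos_max.
  by rewrite ler_piMr// normrX exprn_ile1// sin_max.
rewrite ler_peMr ?addr_ge0//.
by apply: (le_trans q1); exact: ler_norm.
Qed.

Lemma is_derive_turning_angle e : is_derive e 1 turning_angle
  (2 * \int[mu]_(p in `[0, 2 * pi]) dturn e p).
Proof.
pose I := \int[mu]_(p in `[0, 2 * pi]) dturn e p.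
suff H : is_derive e 1 (fun x => \int[mu]_(p in `[0, 2 * pi]) turn x p) I.
  by rewrite /turning_angle; der; rewrite /I; ring.
have ie : `]e - 1, e + 1[%classic e by rewrite /= in_itv/=; lra.
have itu x : `]e - 1, e + 1[%classic x ->
    mu.-integrable `[0, 2 * pi] (EFin \o turn x).
  by move=> _; apply: cont_integrable; exact: continuous_turn.
have du x y : `]e - 1, e + 1[%classic x -> `[0, 2 * pi]%classic y ->
    derivable (turn ^~ y) x 1.
  by move=> _ _; have [] := is_derive_turn1 x y.
(* A dominating constant for the derivative in the parameter: [dturn_bound] gives [4 + |x|], and
   [|x| <= |e| + 1] on the unit neighbourhood of [e]. *)
have iG : mu.-integrable `[0, 2 * pi] (EFin \o cst (5 + `|e|)).
  by apply: cont_integrable; exact: cst_continuous.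
have G0 (y : R) : 0 <= cst (5 + `|e|) y :> R by rewrite /= addr_ge0.
have dE x y : partial1of2 turn x y = dturn x y.
  exact/is_derive_derive1/is_derive_turn1.
have bd x y : `]e - 1, e + 1[%classic x -> `[0, 2 * pi]%classic y ->
    `|partial1of2 turn x y| <= cst (5 + `|e|) y.
  rewrite /= in_itv/= => /andP[x1 x2] _; rewrite dE.
  apply: (le_trans (dturn_bound _ _)).
  have : `|x - e| <= 1 by rewrite ler_norml; lra.
  by have := lerB_dist x e; lra.
have mI : measurable (`[0, 2 * pi]%classic : set (measurableTypeR R)) by [].
have D := @derivable_under_integral R _ _ mu turn _ mI e _ _ ie itu du _ G0 iG bd.
have V :=
  @differentiation_under_integral R _ _ mu turn _ mI e _ _ ie itu du _ G0 iG bd.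
apply: DeriveDef => //; rewrite -derive1E V /I.
by apply: eq_Rintegral => y _; exact: dE.
Qed.

(* The correction [sin p * (4 + e cos p) / quart^(3/2)], whose derivative
   integrates to zero over a turn, makes the integrand of the derivative of the
   turning angle pointwise negative. *)
Let deficit e p : R :=
  24 + 18 * (e * cos p) + 4 * (e * cos p) ^+ 2
  - cos p ^+ 2 * (18 + 14 * (e * cos p) + 2 * (e * cos p) ^+ 2).

(** Written with the weights [sin^2] and [cos^2], the deficit is a convex combination of two
    quadratics in [e cos p], each at least 3. *)
Let deficit_gt0 e p : 0 < deficit e p.
Proof.
have -> : deficit e p =
    (1 - cos p ^+ 2) * (24 + 18 * (e * cos p) + 4 * (e * cos p) ^+ 2)
    + cos p ^+ 2 * (6 + 4 * (e * cos p) + 2 * (e * cos p) ^+ 2).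
  by rewrite /deficit; ring.
set z := e * cos p.
have A : 3 <= 24 + 18 * z + 4 * z ^+ 2 by have := sqr_ge0 (2 * z + 9 / 2); lra.
have B : 3 <= 6 + 4 * z + 2 * z ^+ 2 by have := sqr_ge0 (z + 1); lra.
have c0 := sqr_ge0 (cos p); have s0 := sqr_ge0 (sin p).
rewrite sin2cos2 in s0.
have := ler_wpM2l s0 A; have := ler_wpM2l c0 B; lra.
Qed.

Let is_derive_correction e p : is_derive p 1
  (fun p => sin p * (4 + e * cos p) / Num.sqrt (quart e p) ^+ 3)
  (dturn e p + e * (deficit e p / Num.sqrt (quart e p) ^+ 5)).
Proof.
have dq := is_derive_sqrt_quart e.
have q0 := sqrt_quart_neq0 e p; have q2 := sqr_sqrt_quart e p.
have s2 := sin2cos2 p; rewrite /dturn.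
der; first by rewrite expf_neq0.
move: (Num.sqrt (quart e p)) q0 q2 => q q0 q2.
transitivity (((cos p * (4 + e * cos p) - e * sin p ^+ 2) * q ^+ 2
  + 3 / 2 * e * sin p ^+ 2 * (4 + e * cos p) * (4 + 2 * (e * cos p))) / q ^+ 5).
  by rewrite /=; field.
transitivity (((4 * cos p - e * sin p ^+ 2) * q ^+ 2 + e * deficit e p) / q ^+ 5).
  by rewrite q2 /quart /deficit s2; congr (_ / _); field.
by field.
Qed.

Lemma dturning_angle_lt0 e : 0 < e ->
  \int[mu]_(p in `[0, 2 * pi]) dturn e p < 0.
Proof.
move=> e0.
pose w p := deficit e p / Num.sqrt (quart e p) ^+ 5.
have w0 p : 0 < w p by rewrite divr_gt0// exprn_gt0// sqrt_quart_gt0.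
have [V [V0 dV]] : exists F, F 0 = 0 /\ forall x : R, is_derive x 1 F (w x).
  apply: ex_primitive; have dq := is_derive_sqrt_quart e.
  rewrite /w /deficit; dercont.
  by rewrite expf_neq0// sqrt_quart_neq0.
have pi0 : 0 < 2 * pi :> R by rewrite mulr_gt0// pi_gt0.
have dc := is_derive_correction e.
have dF p : is_derive p 1 (fun p => sin p * (4 + e * cos p)
    / Num.sqrt (quart e p) ^+ 3 - e * V p) (dturn e p).
  by der; rewrite /w; ring.
rewrite (Rintegral_FTC2 (ltW pi0) (@continuous_dturn e) dF).
rewrite V0 sin0 mulr_natl sin2pi !mul0r !sub0r mulr0 oppr0 subr0 oppr_lt0.
by rewrite mulr_gt0// -V0; apply: (is_derive_gt0_lt dV w0); rewrite -mulr_natl.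
Qed.

Lemma turning_angle_lt x y : 0 <= x -> x < y -> turning_angle y < turning_angle x.
Proof.
move=> x0 xy; have dT := is_derive_turning_angle.
(* The derivative vanishes at 0, a point that the mean value theorem may return when [x = 0]. On the
   half from [m] to [y] it is strictly negative, and on the other half a weak inequality
   suffices. *)
pose m := (x + y) / 2.
have [c /andP[xc _] Hc] := is_derive_mvt (ltac:(rewrite /m; lra) : x <= m) dT.
have [d /andP[md _] Hd] := is_derive_mvt (ltac:(rewrite /m; lra) : m <= y) dT.
have Hd0 := @dturning_angle_lt0 d ltac:(move: md; rewrite /m; lra).
have ym : 0 < y - m by rewrite /m; lra.
apply: (@lt_le_trans _ _ (turning_angle m)).
  by rewrite -subr_lt0 Hd nmulr_rlt0// pmulr_rlt0.
rewrite -subr_le0 Hc; have [c0|c0] := ltP 0 c.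
  rewrite nmulr_rle0 ?pmulr_rlt0 ?dturning_angle_lt0//.
  by rewrite /m; lra.
have -> : c = 0 by lra.
rewrite (_ : \int[mu]_(p in `[0, 2 * pi]) dturn 0 p = 0) ?mulr0 ?mul0r//.
have dc := is_derive_correction 0.
have dF p : is_derive p 1 (fun p => sin p * (4 + 0 * cos p)
    / Num.sqrt (quart 0 p) ^+ 3) (dturn 0 p).
  by der; rewrite mul0r addr0.
rewrite (Rintegral_FTC2 _ (@continuous_dturn 0) dF).
  by rewrite sin0 mulr_natl sin2pi !mul0r subrr.
by rewrite mulr_ge0// pi_ge0.
Qed.

Lemma turning_angle0 : turning_angle 0 = 4 * pi / Num.sqrt 6.
Proof.
rewrite /turning_angle; under eq_Rintegral => p _.
  rewrite /turn /quart !mul0r expr0n /= mulr0 !addr0; over.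
rewrite Rintegral_cst//= lebesgue_measure_itv/= lte_fin.
by rewrite mulr_gt0 ?pi_gt0// -EFinD/= subr0; ring.
Qed.

Lemma turning_angle_lt2pi e : 0 < e -> turning_angle e < 2 * pi.
Proof.
move=> e0; apply: lt_trans (turning_angle_lt (lexx 0) e0) _.
rewrite turning_angle0 ltr_pdivrMr ?sqrtr_gt0//.
have p0 := pi_gt0 R.
have : 2 < Num.sqrt 6 :> R.
  by rewrite -(ltr_pXn2r (ltn0Sn 1)) ?nnegrE ?sqrtr_ge0// sqr_sqrtr//; lra.
by nra.
Qed.

(** Pair [p] with [p + pi], which changes the sign of [z = e cos p]. The two integrands add up to
    [1/q1 + 1/q2 + z (1/q1 - 1/q2)]; the last term is nonpositive because [quart] is larger where
    the cosine term is positive, and both [q] are at least [m]. The paired sum integrates over a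
    full turn to [turning_angle e]. *)
Lemma turning_angle_le e : turning_angle e <= 4 * pi / Num.sqrt (2 + e ^+ 2).
Proof.
have [G [G0 dG]] := ex_primitive (@continuous_turn e).
have pi0 := pi_ge0 R.
have tP : periodic (turn e) (2 * pi).
  by move=> p; rewrite /turn /quart mulr_natl cosD2pi.
have GP := primitive_periodic dG tP.
have dG2 x : is_derive x 1 (fun x => G x + G (x + pi)) (turn e x + turn e (x + pi)).
  have dGpi : is_derive x 1 (fun x => G (x + pi)) (turn e (x + pi)).
    by dercomp dG; ring.
  by der.
have m0 : 0 < Num.sqrt (2 + e ^+ 2).
  by rewrite sqrtr_gt0; have := sqr_ge0 e; lra.
pose m := Num.sqrt (2 + e ^+ 2).
have dH x : is_derive x 1 (fun x => x * (2 / m) - (G x + G (x + pi)))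
  (2 / m - (turn e x + turn e (x + pi))) by der; ring.
rewrite /turning_angle (Rintegral_FTC2 _ (@continuous_turn e) dG); last first.
  by rewrite mulr_ge0.
have := @is_derive_ge0_le _ _ _ 0 (2 * pi) dH.
rewrite (addrC (2 * pi)) GP add0r mul0r => H.
suff : 2 * (G (2 * pi) - G 0) <= 2 * pi * (2 / m).
  by rewrite /m; lra.
suff : 0 - (G 0 + G pi) <=
  2 * pi * (2 / m) - (G (2 * pi) + (G pi + (G (2 * pi) - G 0))) by lra.
apply: H => [p|]; last by rewrite mulr_ge0.
rewrite /turn cosDpi mulrN.
set q1 := Num.sqrt (quart e p); set q2 := Num.sqrt (quart e (p + pi)).
have mq1 : m <= q1 by apply: ler_wsqrtr; exact: quart_ge.
have mq2 : m <= q2 by apply: ler_wsqrtr; exact: quart_ge.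
have i1 : q1^-1 <= m^-1 by rewrite lef_pV2// posrE sqrt_quart_gt0.
have i2 : q2^-1 <= m^-1 by rewrite lef_pV2// posrE sqrt_quart_gt0.
suff : e * cos p * (q1^-1 - q2^-1) <= 0 by nra.
have [z0|z0] := leP 0 (e * cos p).
  rewrite mulr_ge0_le0// subr_le0 lef_pV2 ?posrE ?sqrt_quart_gt0//.
  by apply: ler_wsqrtr; rewrite /quart cosDpi; nra.
rewrite mulr_le0_ge0 ?subr_ge0 ?(ltW z0)//.
rewrite lef_pV2 ?posrE ?sqrt_quart_gt0//.
by apply: ler_wsqrtr; rewrite /quart cosDpi; nra.
Qed.

Lemma ex_turning_angle (m : nat) : (2 <= m)%N ->
  exists2 e, 0 < e & turning_angle e = 2 * pi / m%:R.
Proof.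
move=> m2; have m2R : 2 <= m%:R :> R by rewrite ler_nat.
have p0 := pi_gt0 R.
have T0 : 2 * pi / m%:R < turning_angle 0.
  rewrite turning_angle0; apply: (@le_lt_trans _ _ pi).
    by rewrite ler_pdivrMr; nra.
  rewrite ltr_pdivlMr ?sqrtr_gt0//.
  have : Num.sqrt 6 < 4 :> R.
    by rewrite -(ltr_pXn2r (ltn0Sn 1)) ?nnegrE ?sqrtr_ge0// sqr_sqrtr//; lra.
  by nra.
(* At [e = 2 m] the square root in [turning_angle_le] exceeds [2 m], so this is a valid right
   endpoint for the intermediate value theorem. *)
have Tm : turning_angle (2 * m%:R) <= 2 * pi / m%:R.
  apply: le_trans (turning_angle_le _) _.
  have : 2 * m%:R <= Num.sqrt (2 + (2 * m%:R) ^+ 2) :> R.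
    rewrite -[leLHS](@ger0_norm _ (2 * m%:R)) -?sqrtr_sqr; last lra.
    by apply: ler_wsqrtr; lra.
  move=> H; rewrite ler_pdivrMr; last lra.
  rewrite mulrAC ler_pdivlMr; last lra.
  by nra.
have [|||e] := @IVT R turning_angle 0 (2 * m%:R) (2 * pi / m%:R).
- by lra.
- exact/continuous_subspaceT/(is_derive_cont is_derive_turning_angle).
- by rewrite ge_min Tm orbT/= le_max (ltW T0).
rewrite in_itv/= => /andP[e0 _] Te; exists e => //.
rewrite lt_def e0 andbT; have [e00|//] := eqVneq e 0.
by move: T0; rewrite -e00 Te ltxx.
Qed.

End Profile.

(** * The energy of one period *)

Section PeriodEnergy.
Context {R : realType}.
Implicit Types (e p x y z : R).

Local Notation mu := (@lebesgue_measure R).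

(* The sum of the two real roots of the quartic under the energy integral. *)
Definition rootsum e : R := (16 / (1 + e ^+ 2)) `^ 3^-1.

Lemma rootsum_gt0 e : 0 < rootsum e.
Proof. by rewrite powR_gt0// divr_gt0//; have := sqr_ge0 e; lra. Qed.

(** For extreme values [a, b = (s/2) (1 -+ e)] the relation [(a + b) (a^2 + b^2) = 8] reads
    [s^3 (1 + e^2) = 16]. *)
Lemma rootsum_cube e : rootsum e ^+ 3 = 16 / (1 + e ^+ 2).
Proof.
rewrite /rootsum -powR_mulrn ?powR_ge0// -powRrM mulVf ?pnatr_eq0// powRr1//.
by rewrite divr_ge0//; have := sqr_ge0 e; lra.
Qed.

(** This is [kappa^2 ds] over one period in the variable [p], with [kappa = (s/2) (1 + e cos p)] and
    [dp = (s/4) sqrt (quart e p) ds]. *)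
Definition period_energy e : R := rootsum e *
  \int[mu]_(p in `[0, 2 * pi]) ((1 + e * cos p) ^+ 2 / Num.sqrt (quart e p)).

Lemma continuous_energy_density e :
  continuous (fun p => (1 + e * cos p) ^+ 2 / Num.sqrt (quart e p)).
Proof.
have dq := is_derive_sqrt_quart e.
by dercont; exact: sqrt_quart_neq0.
Qed.

(** For [N = 3 r^2 - 6 - e^2] the integrand is [(1 + e cos p)^2 (3 r^2 - quart e p)]; over a full
    turn only the terms of the primitive that are linear in [p] contribute. *)
Let is_derive_trig (N : R) e p : is_derive p 1 (fun p =>
    N * p + (2 * N - 4) * e * sin p + (N - 9) * e ^+ 2 * (p + sin p * cos p) / 2
    - 6 * e ^+ 3 * (sin p - sin p ^+ 3 / 3)
    - e ^+ 4 * (3 / 8 * p + 3 / 8 * (sin p * cos p) + sin p * cos p ^+ 3 / 4))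
  ((1 + e * cos p) ^+ 2 * (N - 4 * (e * cos p) - (e * cos p) ^+ 2)).
Proof.
der; rewrite /=.
have s2 := sin2cos2 p; have c0 := cos2Dsin2 p.
set c := cos p in s2 *; set s := sin p in s2 *.
transitivity (N + (2 * N - 4) * e * c + (N - 9) * e ^+ 2 * (1 + c ^+ 2 - s ^+ 2) / 2
 - 6 * e ^+ 3 * (c * (1 - s ^+ 2))
 - e ^+ 4 * (3 / 8 + 3 / 8 * (c ^+ 2 - s ^+ 2) + c ^+ 4 / 4
             - 3 / 4 * s ^+ 2 * c ^+ 2)).
  by field.
by rewrite s2; field.
Qed.

(* AM-GM: [1 / q >= (3 r^2 - q^2) / (2 r^3)] for positive [q] and [r]. *)
Let inv_ge_tangent (q r : R) : 0 < q -> 0 < r ->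
  (3 * r ^+ 2 - q ^+ 2) / (2 * r ^+ 3) <= q^-1.
Proof.
move=> q0 r0; rewrite ler_pdivrMr ?mulr_gt0 ?exprn_gt0// [leRHS]mulrC ler_pdivlMr//.
rewrite -subr_ge0 (_ : _ - _ = (r - q) ^+ 2 * (2 * r + q)); last by ring.
by rewrite mulr_ge0 ?sqr_ge0// addr_ge0 ?mulr_ge0 ?ltW.
Qed.

(** The tangent inequality at a constant [r] bounds the integral below by [2 pi W / r], where
    [2 pi W] is the integral of [(1 + e cos p)^2]. The resulting bound on the squared energy is
    [32/17 pi^2], and [32/17 > 11/6]. *)
Lemma period_energy_ge e : Num.sqrt (11 / 6) * pi <= period_energy e.
Proof.
have p0 := pi_gt0 R; have s0 := rootsum_gt0 e; have s3 := rootsum_cube e.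
pose u := e ^+ 2; have u0 : 0 <= u by exact: sqr_ge0.
pose W := 1 + u / 2; have W1 : 1 <= W by rewrite /W; lra.
(* The best [r^2] would be the mean of [quart] with weight [(1 + e cos p)^2], that is
   [(6 + 17/2 u + 7/8 u^2) / W]. The choice [17/2 W] dominates it: in [17/2 W^2] the linear
   coefficient agrees and the other two are larger. *)
pose r := Num.sqrt (17 / 2 * W).
have r0 : 0 < r by rewrite sqrtr_gt0; lra.
have r2 : r ^+ 2 = 17 / 2 * W by rewrite sqr_sqrtr//; lra.
pose N := 3 * r ^+ 2 - 6 - u.
have dt := is_derive_trig N e.
have ct : continuous (fun p => (1 + e * cos p) ^+ 2 *
    (N - 4 * (e * cos p) - (e * cos p) ^+ 2)).
  by dercont.
have E1 : \int[mu]_(p in `[0, 2 * pi]) ((1 + e * cos p) ^+ 2 *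
    (N - 4 * (e * cos p) - (e * cos p) ^+ 2)) =
    2 * pi * (3 * r ^+ 2 * W - (6 + 17 / 2 * u + 7 / 8 * u ^+ 2)).
  rewrite (Rintegral_FTC2 _ ct dt) ?mulr_ge0 ?(ltW p0)//.
  by rewrite sin0 mulr_natl sin2pi -mulr_natl /N /W /u; field.
have E2 : 2 * pi * W / r <= \int[mu]_(p in `[0, 2 * pi])
    ((1 + e * cos p) ^+ 2 / Num.sqrt (quart e p)).
  have H : \int[mu]_(p in `[0, 2 * pi]) ((2 * r ^+ 3)^-1 * ((1 + e * cos p) ^+ 2 *
    (N - 4 * (e * cos p) - (e * cos p) ^+ 2))) <= \int[mu]_(p in `[0, 2 * pi])
    ((1 + e * cos p) ^+ 2 / Num.sqrt (quart e p)).
    apply: le_Rintegral => //.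
    - by apply: cont_integrable; dercont.
    - by apply: cont_integrable; exact: continuous_energy_density.
    move=> p _; rewrite mulrCA; apply: ler_wpM2l; first exact: sqr_ge0.
    rewrite mulrC; apply: le_trans (inv_ge_tangent (sqrt_quart_gt0 e p) r0).
    rewrite sqr_sqrt_quart /quart /N /u le_eqVlt; apply/orP; left; apply/eqP.
    by congr (_ / _); ring.
  apply: le_trans H; rewrite RintegralZl//; last exact: cont_integrable.
  rewrite E1 -subr_ge0.
  have r3 : r != 0 by rewrite gt_eqF.
  rewrite (_ : _ - _ = 2 * pi * (r ^+ 2 * W -
    (6 + 17 / 2 * u + 7 / 8 * u ^+ 2)) / (2 * r ^+ 3)); last by field.
  rewrite divr_ge0 ?mulr_ge0 ?exprn_ge0 ?(ltW r0) ?(ltW p0)//.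
  by rewrite r2 /W; nra.
(* After cubing, [rootsum_cube] turns this into [4 W^3 >= (2 W - 1)^2], which holds for [W >= 1]. *)
have sW : 4 <= rootsum e ^+ 2 * W.
  have sW0 : 0 <= rootsum e ^+ 2 * W by apply: mulr_ge0; [exact: sqr_ge0|lra].
  rewrite -(ler_pXn2r (ltn0Sn 2)) ?nnegrE//.
  rewrite exprMn -exprM mulnC exprM s3 expr_div_n mulrAC ler_pdivlMr; last first.
    by rewrite exprn_gt0//; rewrite -/u; lra.
  rewrite -/u (_ : u = 2 * W - 2); last by rewrite /W; lra.
  by nra.
apply: (@le_trans _ _ (rootsum e * (2 * pi * W / r))); last first.
  by rewrite /period_energy ler_pM2l.
rewrite -(@ler_pXn2r _ 2)// ?nnegrE; last 2 first.
- by rewrite mulr_ge0 ?sqrtr_ge0// ltW.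
- by rewrite !mulr_ge0 ?invr_ge0 ?(ltW s0) ?(ltW p0) ?(ltW r0)//; lra.
rewrite exprMn sqr_sqrtr; last lra.
rewrite (_ : (rootsum e * _) ^+ 2 = 8 / 17 * (rootsum e ^+ 2 * W) * pi ^+ 2).
  by rewrite ler_wpM2r ?sqr_ge0//; lra.
rewrite !exprMn exprVn r2; have W0 : W != 0 by rewrite gt_eqF//; lra.
by field.
Qed.

End PeriodEnergy.

(** * Periodic solutions of the curvature equation *)

Section Periodic.
Context {R : realType}.
Implicit Types (f g F : R -> R) (t x y P : R).

Lemma periodicM f P (n : nat) : periodic f P -> periodic f (n%:R * P).
Proof. by move=> fP t; rewrite mulr_natl periodicn. Qed.

Lemma periodic_reduce f P t : 0 < P -> periodic f P ->
  exists2 x, 0 <= x <= P & f t = f x.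
Proof.
move=> P0 fP.
exists (t - (Num.floor (t / P))%:~R * P).
  have := floor_itv (t / P) => /andP[].
  rewrite ler_pdivlMr// ltr_pdivrMr// intrD mulrDl mul1r => ? ?.
  by apply/andP; split; lra.
case: (Num.floor (t / P)) => n.
  by rewrite -{1}(subrK (n%:R * P) t) periodicM.
rewrite NegzE mulrNz mulNr opprK.
by rewrite [X in _ = f (_ + X)](_ : _ = (n.+1)%:R * P)// periodicM.
Qed.

Lemma periodic_eq f g P : 0 < P -> periodic f P -> periodic g P ->
  (forall t, 0 <= t <= P -> f t = g t) -> f =1 g.
Proof.
move=> P0 fP gP fg t.
have hP : periodic (fun x => f x - g x) P by move=> x; rewrite fP gP.
have [x xP /eqP] := periodic_reduce t P0 hP.
by rewrite /= (fg _ xP) subrr subr_eq0 => /eqP.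
Qed.

Lemma minimal_period_multiple f T P : 0 < P -> is_minimal_period T f ->
  periodic f P -> exists2 m : nat, (0 < m)%N & P = m%:R * T.
Proof.
move=> P0 [T0 fT minT] fP.
pose n := Num.truncn (P / T).
have PT0 : 0 <= P / T by rewrite divr_ge0 ?ltW.
have /andP[] := truncn_itv PT0; rewrite -/n ler_pdivlMr// ltr_pdivrMr//.
rewrite -natr1 mulrDl mul1r => nP Pn.
have PE : P = n%:R * T.
  apply/eqP; rewrite eq_le nP andbT leNgt; apply/negP => lt.
  have /minT : periodic f (P - n%:R * T).
    move=> t; rewrite addrA -[LHS](periodicM n fT) subrK.
    exact: fP.
  by move=> /(_ ltac:(lra)); lra.
exists n => //; rewrite lt0n; apply/eqP => n0.
by move: P0; rewrite PE n0 mul0r ltxx.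
Qed.

Lemma minimal_period_uniq f S T :
  is_minimal_period S f -> is_minimal_period T f -> S = T.
Proof.
move=> [S0 fS mS] [T0 fT mT]; apply/eqP; rewrite eq_le mS//=.
exact: mT.
Qed.

Lemma primitive_periodicn F f P (n : nat) :
  (forall x : R, is_derive x 1 F (f x)) -> periodic f P ->
  forall x, F (x + n%:R * P) = F x + n%:R * (F P - F 0).
Proof.
move=> dF fP x; elim: n => [|n IH]; first by rewrite !mul0r !addr0.
rewrite -natr1 mulrDl mul1r addrA (primitive_periodic dF fP) IH.
by ring.
Qed.

Lemma cos_lt1 x : 0 < x -> x < 2 * pi -> cos x < 1.
Proof.
move=> x0 x2; rewrite -[x](@divfK _ 2)// mulr_natr cos_mulr2n cos2sin2.
have : 0 < sin (x / 2) by apply: sin_gt0_pi; lra.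
by move=> s0; have := mulr_gt0 s0 s0; lra.
Qed.

Lemma continuous_periodic_bounded f P : 0 < P -> continuous f ->
  periodic f P -> exists2 M, 0 <= M & forall t, `|f t| <= M.
Proof.
move=> P0 cf fP.
have [c _ cM] := @EVT_max R (fun t => `|f t|) 0 P (ltW P0) ltac:(
  apply: continuous_subspaceT => x; apply: continuous_comp;
  [exact: cf|exact: norm_continuous]).
exists `|f c| => // t; have [x xP ->] := periodic_reduce t P0 fP.
by apply: cM; rewrite in_itv.
Qed.

End Periodic.

(** * Phase, profile, and classification of the periodic solutions *)

Section Solutions.
Context {R : realType}.
Implicit Types (k l : R -> R) (p e c t x y z M P : R).

Local Notation mu := (@lebesgue_measure R).

Definition is_solution k k1 := forall t : R,
  is_derive t 1 k (k1 t) /\ is_derive t 1 k1 (1 - 2^-1 * k t ^+ 3).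

Lemma solution_energy k k1 : is_solution k k1 -> forall t x,
  k1 t ^+ 2 + k t ^+ 4 / 4 - 2 * k t = k1 x ^+ 2 + k x ^+ 4 / 4 - 2 * k x.
Proof.
move=> sol t x; have dk z := (sol z).1; have dk1 z := (sol z).2.
apply: (@is_derive_0_is_cst _ (fun t => k1 t ^+ 2 + k t ^+ 4 / 4 - 2 * k t)).
by move=> z; der; rewrite /=; field.
Qed.

Lemma solution_shift k k1 c : is_solution k k1 ->
  is_solution (fun t => k (t + c)) (fun t => k1 (t + c)).
Proof.
move=> sol t; have [dk dk1] := sol (t + c); split.
  by dercomp dk; ring.
by dercomp dk1; ring.
Qed.

(** Gronwall: the squared distance [E] in the phase plane satisfies [|E'| <= C E], so [E] times an
    exponential is monotone on each side of [x], where it vanishes. The common bound [M] supplies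
    the Lipschitz constant of the cubic term. *)
Lemma solution_unique k k1 l l1 M x : is_solution k k1 -> is_solution l l1 ->
  (forall t, `|k t| <= M) -> (forall t, `|l t| <= M) ->
  k x = l x -> k1 x = l1 x -> k =1 l.
Proof.
move=> solk soll kM lM kl kl1 t.
have dk z := (solk z).1; have dk1 z := (solk z).2.
have dl z := (soll z).1; have dl1 z := (soll z).2.
pose C := 1 + 2 * M ^+ 2.
pose E t := (k t - l t) ^+ 2 + (k1 t - l1 t) ^+ 2.
pose E' t := (k t - l t) * (k1 t - l1 t) *
  (2 - (k t ^+ 2 + k t * l t + l t ^+ 2)).
have dE z : is_derive z 1 E (E' z).
  by rewrite /E /E'; der; rewrite /=; field.
have E'C z : - (C * E z) <= E' z <= C * E z.
  rewrite -ler_norml /E' normrM.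
  have : `|2 - (k z ^+ 2 + k z * l z + l z ^+ 2)| <= 2 + 3 * M ^+ 2.
    have := kM z; have := lM z; rewrite !ler_norml => /andP[? ?] /andP[? ?].
    by apply/andP; split; nra.
  have : 2 * `|(k z - l z) * (k1 z - l1 z)| <= E z.
    rewrite /E -ler_pdivlMl// ler_norml.
    have := sqr_ge0 (k z - l z + (k1 z - l1 z)).
    have := sqr_ge0 (k z - l z - (k1 z - l1 z)).
    by move=> ? ?; apply/andP; split; lra.
  have := normr_ge0 ((k z - l z) * (k1 z - l1 z)).
  have := sqr_ge0 M.
  by rewrite /C; nra.
have Ex : E x = 0 by rewrite /E kl kl1 !subrr expr0n addr0.
suff Et : E t = 0.
  have : (k t - l t) ^+ 2 = 0.
    have := sqr_ge0 (k t - l t); have := sqr_ge0 (k1 t - l1 t).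
    by move: Et; rewrite /E; lra.
  by move/eqP; rewrite sqrf_eq0 subr_eq0 => /eqP.
have E0 : 0 <= E t by rewrite addr_ge0 ?sqr_ge0.
have dexp c z : is_derive z 1 (fun z => expR (c * z)) (c * expR (c * z)).
  by dercomp (@is_derive_expR R); ring.
apply/eqP; rewrite eq_le E0 andbT.
have [xt|tx] := leP x t.
  have dF z : is_derive z 1 (fun z => - (E z * expR (- C * z)))
      ((C * E z - E' z) * expR (- C * z)).
    by have de := dexp (- C); der; ring.
  have := is_derive_ge0_le dF _ xt.
  rewrite Ex mul0r oppr0 oppr_ge0 pmulr_lle0 ?expR_gt0//; apply => z.
  by rewrite mulr_ge0 ?expR_ge0//; have := E'C z; lra.
have dF z : is_derive z 1 (fun z => E z * expR (C * z))
    ((C * E z + E' z) * expR (C * z)).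
  by have de := dexp C; der; ring.
have := is_derive_ge0_le dF _ (ltW tx).
rewrite Ex mul0r pmulr_lle0 ?expR_gt0//; apply => z.
by rewrite mulr_ge0 ?expR_ge0//; have := E'C z; lra.
Qed.

Let is_derive_can_inverse (C ph c : R -> R) p : cancel C ph ->
  (forall x : R, is_derive x 1 C (c x)) -> c p != 0 ->
  is_derive (C p) 1 ph (c p)^-1.
Proof.
move=> phC dC c0.
have nK : {near p, cancel C ph} by near do exact: phC.
have nC : \forall x \near p, {for x, continuous C}.
  by near do exact: (is_derive_cont dC).
exact: (is_derive_inverse nK nC (dC p) c0).
Unshelve. all: end_near. Qed.

(** The equation for the phase is autonomous with positive right-hand side, so its solution is the
    inverse of the primitive [C] of the reciprocal, and the time needed for a full turn is
    [C (2 pi)]. *)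
Let ex_phase e : exists phT : (R -> R) * R, [/\ phT.1 0 = 0,
  forall t : R, is_derive t 1 phT.1 (rootsum e / 4 * Num.sqrt (quart e (phT.1 t))),
  0 < phT.2 & forall t, phT.1 (t + phT.2) = phT.1 t + 2 * pi].
Proof.
have s0 := rootsum_gt0 e.
pose c p := 4 / (rootsum e * Num.sqrt (quart e p)).
have sq0 p : 0 < rootsum e * Num.sqrt (quart e p).
  by rewrite mulr_gt0// sqrt_quart_gt0.
have c0 p : 0 < c p by rewrite divr_gt0.
have cc : continuous c.
  have dq := is_derive_sqrt_quart e.
  by rewrite /c; dercont; rewrite gt_eqF.
have [C [C0 dC]] := ex_primitive cc.
have cP : periodic c (2 * pi) by move=> p; rewrite /c /quart (mulr_natl pi) cosD2pi.
(* A uniform positive lower bound for the derivative of [C]; it makes [C] unbounded in both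
   directions, hence onto. *)
pose d := 4 / (rootsum e * Num.sqrt (6 + 4 * `|e| + 2 * e ^+ 2)).
have M0 : 0 < 6 + 4 * `|e| + 2 * e ^+ 2.
  by have := normr_ge0 e; have := sqr_ge0 e; lra.
have d0 : 0 < d by rewrite divr_gt0// mulr_gt0// sqrtr_gt0.
have dc p : d <= c p.
  rewrite /d /c ler_pM2l// lef_pV2 ?posrE ?mulr_gt0 ?sqrtr_gt0 ?quart_gt0//.
  rewrite ler_pM2l//; apply: ler_wsqrtr; rewrite /quart.
  have : (e * cos p) ^+ 2 <= e ^+ 2.
    by have := mulr_ge0 (sqr_ge0 e) (sqr_ge0 (sin p)); rewrite sin2cos2; lra.
  have : e * cos p <= `|e|.
    apply: le_trans (ler_norm _) _; rewrite normrM ler_piMr//; exact: cos_max.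
  by lra.
have Cd x y : x <= y -> d * (y - x) <= C y - C x.
  move=> xy; have [z _ ->] := is_derive_mvt xy dC.
  by rewrite ler_wpM2r ?subr_ge0.
have Cinj : injective C.
  move=> x y Cxy; apply/eqP; rewrite eq_le.
  apply/andP; split; rewrite leNgt; apply/negP => /(is_derive_gt0_lt dC c0);
  by rewrite Cxy ltxx.
have Csurj t : exists p, C p = t.
  pose B := `|t| / d; have B0 : 0 <= B by rewrite divr_ge0// ltW.
  have dB : d * B = `|t| by rewrite mulrC divfK// gt_eqF.
  have H1 := Cd 0 B B0; have H2 := Cd (- B) 0 ltac:(lra).
  rewrite C0 in H1 H2.
  have tn := ler_norm t; have tm := ler_norm (- t); rewrite normrN in tm.
  have [|||p _ pt] := @IVT R C (- B) B t; last by exists p.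
  - by lra.
  - by apply: continuous_subspaceT; exact: (is_derive_cont dC).
  - rewrite ge_min le_max; apply/andP; split; apply/orP; [left|right]; lra.
pose ph t := projT1 (cid (Csurj t)).
have Cph t : C (ph t) = t by rewrite /ph; case: cid.
have phC p : ph (C p) = p by apply: Cinj; rewrite Cph.
exists (ph, C (2 * pi)); split => /=.
- by apply: Cinj; rewrite Cph C0.
- move=> t; rewrite -{1}(Cph t).
  have c0t : c (ph t) != 0 by rewrite gt_eqF.
  apply: is_derive1_eq (is_derive_can_inverse phC dC c0t) _.
  by rewrite /c invf_div [RHS]mulrAC.
- by rewrite -C0; apply: (is_derive_gt0_lt dC c0); rewrite mulr_gt0// pi_gt0.
- move=> t; apply: Cinj; rewrite Cph (primitive_periodic dC cP) Cph C0.
  by ring.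
Qed.

Definition phase e : R -> R := (projT1 (cid (ex_phase e))).1.
Definition period e : R := (projT1 (cid (ex_phase e))).2.

Lemma phase0 e : phase e 0 = 0.
Proof. by rewrite /phase; case: cid => ? []. Qed.

Lemma is_derive_phase e t :
  is_derive t 1 (phase e) (rootsum e / 4 * Num.sqrt (quart e (phase e t))).
Proof. by rewrite /phase; case: cid => ? []. Qed.

Lemma period_gt0 e : 0 < period e.
Proof. by rewrite /period; case: cid => ? []. Qed.

Lemma phaseD e t : phase e (t + period e) = phase e t + 2 * pi.
Proof. by rewrite /phase /period; case: cid => ? []. Qed.

Lemma phaseDn e t (n : nat) :
  phase e (t + n%:R * period e) = phase e t + n%:R * (2 * pi).
Proof.
elim: n => [|n IH]; first by rewrite !mul0r !addr0.
by rewrite -natr1 !(mulrDl n%:R) !mul1r !addrA phaseD IH.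
Qed.

Lemma phase_lt e x y : x < y -> phase e x < phase e y.
Proof.
apply: (is_derive_gt0_lt (is_derive_phase e)) => t.
by rewrite mulr_gt0 ?sqrt_quart_gt0// divr_gt0// rootsum_gt0.
Qed.

Definition profile e t := rootsum e / 2 * (1 + e * cos (phase e t)).

Definition dprofile e t := - (rootsum e ^+ 2 * e / 8 *
  (sin (phase e t) * Num.sqrt (quart e (phase e t)))).

Lemma profile_solution e : is_solution (profile e) (dprofile e).
Proof.
have dp := is_derive_phase e; split; rewrite /profile /dprofile.
  by der; field.
have dq : is_derive t 1 (fun t => Num.sqrt (quart e (phase e t)))
   ((2 * Num.sqrt (quart e (phase e t)))^-1 * (- (e * sin (phase e t)) *
     (4 + 2 * (e * cos (phase e t)))) *
     (rootsum e / 4 * Num.sqrt (quart e (phase e t)))).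
  exact: (derive_compf (is_derive_sqrt_quart e (phase e t)) (dp t)).
der; have q0 := sqrt_quart_neq0 e (phase e t).
have q2 := sqr_sqrt_quart e (phase e t).
have s2 := sin2cos2 (phase e t).
move: (Num.sqrt _) q0 q2 => q q0 q2.
have e0 : 1 + e ^+ 2 != 0 by rewrite gt_eqF//; have := sqr_ge0 e; lra.
transitivity (- (rootsum e ^+ 3 * e / 32 * (cos (phase e t) * q ^+ 2
  - e * sin (phase e t) ^+ 2 * (2 + e * cos (phase e t))))); first by field.
rewrite q2 s2 exprMn expr_div_n rootsum_cube /quart; by field.
Qed.

Lemma profile0 e : profile e 0 = rootsum e / 2 * (1 + e).
Proof. by rewrite /profile phase0 cos0 mulr1. Qed.

Lemma dprofile0 e : dprofile e 0 = 0.
Proof. by rewrite /dprofile phase0 sin0 mul0r mulr0 oppr0. Qed.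

Lemma profile_periodic e : periodic (profile e) (period e).
Proof. by move=> t; rewrite /profile phaseD (mulr_natl pi) cosD2pi. Qed.

(** The profile has its maximum at 0, and a period [S] brings the cosine of the phase back to 1; a
    smaller [S] would have phase strictly between 0 and [2 pi]. *)
Lemma profile_minimal_period e : 0 < e ->
  is_minimal_period (period e) (profile e).
Proof.
move=> e0; split; [exact: period_gt0|exact: profile_periodic|].
move=> S S0 /(_ 0); rewrite add0r profile0 /profile => SE.
have s0 := rootsum_gt0 e.
have cS : cos (phase e S) = 1.
  have s20 : rootsum e / 2 != 0 by rewrite gt_eqF// divr_gt0.
  have e00 : e != 0 by rewrite gt_eqF.
  by move: SE => /(mulfI s20)/addrI; rewrite -[RHS]mulr1 => /(mulfI e00).
rewrite leNgt; apply/negP => ST.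
have := phase_lt e S0; have := phase_lt e ST.
rewrite -[period e]add0r phaseD phase0 add0r => p2 p0.
by have := cos_lt1 p0 p2; rewrite cS ltxx.
Qed.

(** Substitution by the phase: [2 G (phase e (t + c))] is a primitive of the shifted profile, and
    over [m] periods the phase advances by [m] full turns, whatever [c]. *)
Lemma profile_integral e c (m : nat) :
  \int[mu]_(t in `[0, m%:R * period e]) profile e (t + c) =
  m%:R * turning_angle e.
Proof.
have [G [G0 dG]] := ex_primitive (@continuous_turn R e).
have tP : periodic (turn e) (2 * pi).
  by move=> p; rewrite /turn /quart (mulr_natl pi) cosD2pi.
have dF t : is_derive t 1 (fun t => 2 * G (phase e (t + c))) (profile e (t + c)).
  have d1 : is_derive t 1 (fun t => phase e (t + c))
      (rootsum e / 4 * Num.sqrt (quart e (phase e (t + c)))).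
    by dercomp (is_derive_phase e); ring.
  have d2 := @derive_compf _ G (fun t => phase e (t + c)) t _ _ (dG _) d1.
  have q0 := sqrt_quart_neq0 e (phase e (t + c)).
  by der; rewrite /turn /profile; field.
have cp : continuous (fun t => profile e (t + c)).
  have dp t := (solution_shift c (profile_solution e) t).1.
  exact: (is_derive_cont dp).
have P0 : 0 <= m%:R * period e by rewrite mulr_ge0// ltW// period_gt0.
have pi0 : 0 <= 2 * pi :> R by rewrite mulr_ge0// pi_ge0.
rewrite (Rintegral_FTC2 P0 cp dF) add0r (addrC _ c) phaseDn.
rewrite (primitive_periodicn m dG tP) /turning_angle.
by rewrite (Rintegral_FTC2 pi0 (@continuous_turn R e) dG); ring.
Qed.

Lemma profile_integral_sqr e c (m : nat) :
  \int[mu]_(t in `[0, m%:R * period e]) (profile e (t + c) ^+ 2) =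
  m%:R * period_energy e.
Proof.
pose w p : R := (1 + e * cos p) ^+ 2 / Num.sqrt (quart e p).
have [G [G0 dG]] := ex_primitive (@continuous_energy_density R e : continuous w).
have tP : periodic w (2 * pi).
  by move=> p; rewrite /w /quart (mulr_natl pi) cosD2pi.
have dF t : is_derive t 1 (fun t => rootsum e * G (phase e (t + c)))
    (profile e (t + c) ^+ 2).
  have d1 : is_derive t 1 (fun t => phase e (t + c))
      (rootsum e / 4 * Num.sqrt (quart e (phase e (t + c)))).
    by dercomp (is_derive_phase e); ring.
  have d2 := @derive_compf _ G (fun t => phase e (t + c)) t _ _ (dG _) d1.
  have q0 := sqrt_quart_neq0 e (phase e (t + c)).
  by der; rewrite /w /profile; field.
have cp : continuous (fun t => profile e (t + c) ^+ 2).
  have dp t := (solution_shift c (profile_solution e) t).1.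
  by dercont.
have P0 : 0 <= m%:R * period e by rewrite mulr_ge0// ltW// period_gt0.
have pi0 : 0 <= 2 * pi :> R by rewrite mulr_ge0// pi_ge0.
rewrite (Rintegral_FTC2 P0 cp dF) add0r (addrC _ c) phaseDn.
rewrite (primitive_periodicn m dG tP) /period_energy.
by rewrite (Rintegral_FTC2 pi0 (@continuous_energy_density R e) dG); rewrite -/w; ring.
Qed.

Let max_derive0 k k1 x : (forall t : R, is_derive t 1 k (k1 t)) ->
  (forall t, k t <= k x) -> k1 x = 0.
Proof.
move=> dk kx; have H := @derive1_at_max R k (x - 1) (x + 1) x.
have {}H : is_derive x 1 k 0.
  by apply: H => //; rewrite ?in_itv/=; lra.
by rewrite -(is_derive_derive1 (dk x)); exact: is_derive_derive1.
Qed.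

(* At its extreme values [a < b] the solution has zero derivative, so energy
   conservation gives [(a + b) (a^2 + b^2) = 8], which is the relation between
   the roots of the quartic under the energy integral of [profile]. *)
Lemma solution_is_profile k k1 P : 0 < P -> periodic k P -> is_solution k k1 ->
  ~ (exists c, forall t, k t = c) ->
  exists e c, 0 < e /\ forall t, k t = profile e (t + c).
Proof.
move=> P0 kP sol nc; have dk t := (sol t).1; have dk1 t := (sol t).2.
have ck : continuous k by exact: (is_derive_cont dk).
have [xb _ kb] := @EVT_max R k 0 P (ltW P0) (continuous_subspaceT ck).
have [xa _ ka] := @EVT_min R k 0 P (ltW P0) (continuous_subspaceT ck).
have {}kb t : k t <= k xb.
  by have [x xP ->] := periodic_reduce t P0 kP; apply: kb; rewrite in_itv.
have {}ka t : k xa <= k t.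
  by have [x xP ->] := periodic_reduce t P0 kP; apply: ka; rewrite in_itv.
have k1b : k1 xb = 0 by exact: max_derive0 kb.
have k1a : k1 xa = 0.
  have dN t : is_derive t 1 (fun t => - k t) (- k1 t) by der.
  have H : forall t, - k t <= - k xa by move=> t; rewrite lerN2.
  by have := max_derive0 dN H => /eqP; rewrite oppr_eq0 => /eqP.
set b := k xb in kb; set a := k xa in ka.
have ab : a < b.
  rewrite ltNge; apply/negP => ba; apply: nc; exists a => t.
  by apply/eqP; rewrite eq_le ka andbT; apply: le_trans (kb t) ba.
have : (b - a) * ((a + b) * (a ^+ 2 + b ^+ 2) - 8) = 0.
  have := solution_energy sol xb xa; rewrite k1b k1a -/a -/b expr0n/=.
  by move=> H; lra.
move/eqP; rewrite mulf_eq0 subr_eq0 gt_eqF//= subr_eq0 => /eqP ab8.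
have s0 : 0 < a + b.
  have h : 0 <= a ^+ 2 + b ^+ 2 by rewrite addr_ge0 ?sqr_ge0.
  by rewrite ltNge; apply/negP => s0; have := mulr_ge0_le0 h s0; lra.
pose e := (b - a) / (a + b).
have e0 : 0 < e by rewrite divr_gt0// subr_gt0.
have se : rootsum e = a + b.
  have s00 : a + b != 0 by rewrite gt_eqF.
  apply: (@pexpIrn _ 3); rewrite ?nnegrE ?(ltW s0) ?(ltW (rootsum_gt0 _))//.
  have q0 : a ^+ 2 + b ^+ 2 != 0.
    by apply/eqP => q0; move: ab8; rewrite q0 mulr0; lra.
  rewrite rootsum_cube (_ : 1 + e ^+ 2 = 2 * (a ^+ 2 + b ^+ 2) / (a + b) ^+ 2).
    transitivity (8 * (a + b) ^+ 2 / (a ^+ 2 + b ^+ 2)).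
      by field; rewrite s00 q0.
    by rewrite -[X in X * _ / _]ab8; field.
  by rewrite /e; field.
(* The shift puts the maximum of [k] at phase 0, where value and derivative of the profile are
   known. *)
exists e, (- xb); split=> //.
have [M M0 kM] := continuous_periodic_bounded P0 ck kP.
have cp : continuous (profile e).
  by have dp t := (profile_solution e t).1; exact: (is_derive_cont dp).
have [N N0 lN] := continuous_periodic_bounded (period_gt0 e) cp (@profile_periodic e).
apply: (@solution_unique _ _ _ _ (M + N) xb sol
  (solution_shift (- xb) (profile_solution e))).
- by move=> t; apply: le_trans (kM t) _; lra.
- by move=> t; apply: le_trans (lN _) _; lra.
- by rewrite subrr profile0 se /e -/b; field; rewrite gt_eqF.
- by rewrite subrr dprofile0.
Qed.

Lemma minimal_period_shift (f : R -> R) T c : is_minimal_period T f ->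
  is_minimal_period T (fun t => f (t + c)).
Proof.
move=> [T0 fT minT]; split=> // [t|S S0 fS]; first by rewrite addrAC fT.
apply: minT => // t; have := fS (t - c).
by rewrite subrK addrAC subrK.
Qed.

(* A closed solution of total curvature [2 pi] turns by [2 pi / m] over each of
   its [m] periods; one period turns by less than [2 pi], so [m >= 2]. *)
Lemma closed_solution k k1 P : 0 < P -> periodic k P -> is_solution k k1 ->
  ~ (exists c, forall t, k t = c) ->
  \int[mu]_(t in `[0, P]) k t = 2 * pi ->
  exists (m : nat) e c, [/\ (2 <= m)%N, 0 < e, turning_angle e = 2 * pi / m%:R,
    is_minimal_period (P / m%:R) k & forall t, k t = profile e (t + c)] /\
    \int[mu]_(t in `[0, P]) (k t ^+ 2) = m%:R * period_energy e.
Proof.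
move=> P0 kP sol nc kint.
have [e [c [e0 kE]]] := solution_is_profile P0 kP sol nc.
have {}kE : k = (fun t => profile e (t + c)) by exact/funext.
have kmin : is_minimal_period (period e) k.
  by rewrite kE; exact: minimal_period_shift (profile_minimal_period e0).
have [m m0 PE] := minimal_period_multiple P0 kmin kP.
have mR : m%:R != 0 :> R by rewrite pnatr_eq0 -lt0n.
have TE : turning_angle e = 2 * pi / m%:R.
  rewrite -kint PE kE profile_integral; field; exact: mR.
exists m, e, c; split; last by rewrite PE kE profile_integral_sqr.
split=> //.
- rewrite ltnNge; apply/negP => m1; have {m1}mE : m = 1%N.
    by apply/eqP; rewrite eqn_leq m1.
  by have := turning_angle_lt2pi e0; rewrite TE mE divr1 ltxx.
- by rewrite PE mulrC mulKf.
- by move=> t; rewrite kE.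
Qed.

End Solutions.

(** * Curves with prescribed curvature *)

Section SmoothAlgebra.
Context {R : realType}.
Implicit Types (f g : R -> R) (G : set (R -> R)) (a c t x : R).

(** The algebra of functions generated by [G]. If it contains the derivatives of its generators, it
    is stable under differentiation, which proves smoothness of all its members without computing
    iterated derivatives. *)
Inductive generated G : (R -> R) -> Prop :=
| generated_gen f : G f -> generated G f
| generated_cst c : generated G (fun=> c)
| generated_add f g : generated G f -> generated G g ->
    generated G (fun t => f t + g t)
| generated_mul f g : generated G f -> generated G g ->
    generated G (fun t => f t * g t).

Lemma generated_exp G f n : generated G f -> generated G (fun t => f t ^+ n).
Proof.
move=> Gf; elim: n => [|n IH]; first exact: generated_cst.
rewrite (_ : (fun t => _) = (fun t => f t * f t ^+ n)); last first.
  by apply/funext => t; rewrite exprS.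
exact: generated_mul.
Qed.

Lemma generated_smooth G :
  (forall f, G f -> exists2 g, generated G g & forall t : R, is_derive t 1 f (g t)) ->
  forall f, generated G f -> smooth f.
Proof.
move=> dG.
have dgen f : generated G f ->
    exists2 g, generated G g & forall t : R, is_derive t 1 f (g t).
  elim=> {f} [f /dG//|c|f g _ [f' Gf' df] _ [g' Gg' dg]|
    f g Gf [f' Gf' df] Gg [g' Gg' dg]].
  - by exists (fun=> 0); [exact: generated_cst|move=> t; exact: deriveC].
  - exists (fun t => f' t + g' t); first exact: generated_add.
    by move=> t; der.
  - exists (fun t => f' t * g t + f t * g' t).
      by apply: generated_add; apply: generated_mul.
    by move=> t; der.
move=> f Gf n; elim: n f Gf => [|n IH] f Gf t.
  by have [g _ /(_ t)[]] := dgen f Gf.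
have [g Gg dg] := dgen f Gf.
rewrite /derive1n iterSr (_ : derive1 f = g); first exact: IH.
by apply/funext => x; exact: is_derive_derive1.
Qed.

Lemma smooth_is_derive f t : smooth f -> is_derive t 1 f (derive1 f t).
Proof. by move=> /(_ 0%N t)/derivable_is_derive. Qed.

Lemma smooth_derive1 f : smooth f -> smooth (derive1 f).
Proof. by move=> sf n t; have := sf n.+1 t; rewrite /derive1n iterSr. Qed.

End SmoothAlgebra.

(** * Frenet frames, area and circles *)

Section FramedCurves.
Context {R : realType}.
Implicit Types (gamma : R -> R * R) (k u v : R -> R) (a b c t x P : R).

Local Notation mu := (@lebesgue_measure R).

(* [(u, v)] is the unit tangent and [k] the curvature of [gamma]. *)
Definition framed gamma k u v := forall t : R,
  [/\ is_derive t 1 (fun t => (gamma t).1) (u t),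
      is_derive t 1 (fun t => (gamma t).2) (v t),
      is_derive t 1 u (- (k t * v t)), is_derive t 1 v (k t * u t)
    & u t ^+ 2 + v t ^+ 2 = 1].

Lemma dcurve_arclengthE gamma : arclength gamma -> forall t,
  (dcurve gamma t).1 ^+ 2 + (dcurve gamma t).2 ^+ 2 = 1.
Proof.
move=> al t; have := al t; rewrite /speed /enorm /dot => H.
rewrite !expr2 -[LHS]sqr_sqrtr ?H ?expr1n//.
by rewrite addr_ge0// -expr2 sqr_ge0.
Qed.

Lemma tangent_arclength gamma : arclength gamma -> tangent gamma = dcurve gamma.
Proof.
by move=> al; apply/funext => t; rewrite /tangent /darc al !divr1; case: dcurve.
Qed.

Lemma framed_dcurve gamma k u v : framed gamma k u v ->
  dcurve gamma = (fun t => (u t, v t)).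
Proof.
move=> F; apply/funext => t; have [dx dy _ _ _] := F t.
by rewrite /dcurve (is_derive_derive1 dx) (is_derive_derive1 dy).
Qed.

Lemma framed_arclength gamma k u v : framed gamma k u v -> arclength gamma.
Proof.
move=> F t; have [_ _ _ _ uv] := F t.
by rewrite /speed (framed_dcurve F) /enorm /dot /= -!expr2 uv sqrtr1.
Qed.

Lemma framed_tangent gamma k u v : framed gamma k u v ->
  tangent gamma = (fun t => (u t, v t)).
Proof.
by move=> F; rewrite (tangent_arclength (framed_arclength F)) (framed_dcurve F).
Qed.

Lemma framed_curvature gamma k u v : framed gamma k u v ->
  curvature gamma = k.
Proof.
move=> F; apply/funext => t; have [_ _ du dv uv] := F t.
rewrite /curvature /normal (framed_tangent F) /darc (framed_arclength F) !divr1.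
rewrite /dcurve /dot /= (is_derive_derive1 du) (is_derive_derive1 dv).
by rewrite mulrNN -!mulrA -mulrDr -!expr2 addrC uv mulr1.
Qed.

Lemma framed_integral gamma k u v P f : framed gamma k u v ->
  curve_integral P gamma f = \int[mu]_(t in `[0, P]) f t.
Proof.
move=> F; apply: eq_Rintegral => t _.
by rewrite (framed_arclength F) mulr1.
Qed.

Lemma framed_total_curvature gamma k u v P : framed gamma k u v ->
  winding_number P gamma = 1 -> \int[mu]_(t in `[0, P]) k t = 2 * pi.
Proof.
move=> F; rewrite /winding_number (framed_integral _ _ F) (framed_curvature F).
have pi0 : 2 * pi != 0 :> R by rewrite mulf_neq0 ?gt_eqF ?pi_gt0.
by move=> H; apply: (mulfI (invr_neq0 pi0)); rewrite H mulVf.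
Qed.

(* The Frenet equations and the equation for [k] make
   [gamma - (k' tau - k^2 / 2 nu)] constant. *)
Lemma framed_solution gamma k k1 u v : framed gamma k u v -> is_solution k k1 ->
  exists a b, forall t,
    (gamma t).1 = a + k1 t * u t + k t ^+ 2 / 2 * v t /\
    (gamma t).2 = b + k1 t * v t - k t ^+ 2 / 2 * u t.
Proof.
move=> F sol; have dk t := (sol t).1; have dk1 t := (sol t).2.
have dx t : is_derive t 1 (fun t => (gamma t).1) (u t) by have [] := F t.
have dy t : is_derive t 1 (fun t => (gamma t).2) (v t) by have [] := F t.
have du t : is_derive t 1 u (- (k t * v t)) by have [] := F t.
have dv t : is_derive t 1 v (k t * u t) by have [] := F t.
pose X t := k1 t * u t + k t ^+ 2 / 2 * v t.
pose Y t := k1 t * v t - k t ^+ 2 / 2 * u t.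
have dX t : is_derive t 1 X (u t) by rewrite /X; der; rewrite /=; field.
have dY t : is_derive t 1 Y (v t) by rewrite /Y; der; rewrite /=; field.
exists ((gamma 0).1 - X 0), ((gamma 0).2 - Y 0) => t; split.
  by have := eq_is_derive_cst dx dX t 0; rewrite -/(X t) /X; lra.
by have := eq_is_derive_cst dy dY t 0; rewrite -/(Y t) /Y; lra.
Qed.

(** By [framed_solution], [nu . gamma] equals [- k^2 / 2] plus a constant combination of [u] and
    [v], the derivatives of the coordinates; these integrate to zero since the curve is closed. *)
Lemma framed_area gamma k k1 u v P : 0 < P -> framed gamma k u v ->
  is_solution k k1 -> periodic gamma P ->
  algebraic_area P gamma = 4^-1 * elastic_energy P gamma.
Proof.
move=> P0 F sol gP; have [a [b gE]] := framed_solution F sol.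
rewrite /algebraic_area /elastic_energy !(framed_integral _ _ F).
rewrite (framed_curvature F) /normal (framed_tangent F) /dot /=.
have dk t := (sol t).1.
have dx t : is_derive t 1 (fun t => (gamma t).1) (u t) by have [] := F t.
have dy t : is_derive t 1 (fun t => (gamma t).2) (v t) by have [] := F t.
have ck2 : continuous (fun t => k t ^+ 2) by dercont.
have [K [K0 dK]] := ex_primitive ck2.
rewrite (Rintegral_FTC2 (ltW P0) ck2 dK).
have cuv : continuous (fun t => - v t * (gamma t).1 + u t * (gamma t).2).
  have du t : is_derive t 1 u (- (k t * v t)) by have [] := F t.
  have dv t : is_derive t 1 v (k t * u t) by have [] := F t.
  by dercont.
have dA t : is_derive t 1
    (fun t => - 2^-1 * K t - a * (gamma t).2 + b * (gamma t).1)
    (- v t * (gamma t).1 + u t * (gamma t).2).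
  der; have [-> ->] := gE t; have [_ _ _ _ uv] := F t.
  apply/eqP; rewrite -subr_eq0; apply/eqP.
  transitivity (2^-1 * k t ^+ 2 * (u t ^+ 2 + v t ^+ 2 - 1)); first by field.
  by rewrite uv subrr mulr0.
have gP0 : gamma P = gamma 0 by have := gP 0; rewrite add0r.
by rewrite (Rintegral_FTC2 (ltW P0) cuv dA) gP0; field.
Qed.

Lemma ex_angle a b : a ^+ 2 + b ^+ 2 = 1 -> exists th, cos th = a /\ sin th = b.
Proof.
move=> ab; have a1 : -1 <= a <= 1.
  by have := sqr_ge0 b => b0; apply/andP; split; nra.
have ca : cos (acos a) = a by apply: acosK; rewrite in_itv.
have sa : sin (acos a) = `|b|.
  by rewrite sin_acos// -[RHS]sqrtr_sqr; congr Num.sqrt; lra.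
have [b0|b0] := leP 0 b.
  by exists (acos a); rewrite sa ger0_norm.
by exists (- acos a); rewrite cosN sinN sa ltr0_norm ?opprK.
Qed.

(** Both unit vectors rotate at speed [k], so their inner product keeps its initial value 1, which
    forces them to coincide. *)
Lemma framed_cos_sin gamma k u v (th : R -> R) : framed gamma k u v ->
  (forall t : R, is_derive t 1 th (k t)) ->
  cos (th 0) = u 0 -> sin (th 0) = v 0 ->
  forall t, u t = cos (th t) /\ v t = sin (th t).
Proof.
move=> F dth c0 s0 t.
have du x : is_derive x 1 u (- (k x * v x)) by have [] := F x.
have dv x : is_derive x 1 v (k x * u x) by have [] := F x.
have W1 : u t * cos (th t) + v t * sin (th t) = 1.
  have dW x : is_derive x 1 (fun t => u t * cos (th t) + v t * sin (th t)) 0.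
    by der; ring.
  have [_ _ _ _ <-] := F 0.
  by rewrite (is_derive_0_is_cst t 0 dW) c0 s0 !expr2.
have [_ _ _ _ uv] := F t; have cs := cos2Dsin2 (th t).
have : (u t - cos (th t)) ^+ 2 + (v t - sin (th t)) ^+ 2 = 0.
  have -> : (u t - cos (th t)) ^+ 2 + (v t - sin (th t)) ^+ 2 =
    (u t ^+ 2 + v t ^+ 2) + (cos (th t) ^+ 2 + sin (th t) ^+ 2)
    - 2 * (u t * cos (th t) + v t * sin (th t)) by ring.
  by rewrite uv cs W1; ring.
move/eqP; rewrite paddr_eq0 ?sqr_ge0// !sqrf_eq0 !subr_eq0.
by move=> /andP[/eqP -> /eqP ->].
Qed.

(** A constant solution has [c^3 = 2], so the radius [c^2 / 2] is [1 / c]. As [is_circle] asks for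
    the whole circle, each of its points must be reached: the tangent angle [c t + th0] takes every
    real value. *)
Lemma framed_cst_circle gamma k k1 u v c : framed gamma k u v ->
  is_solution k k1 -> (forall t, k t = c) -> is_circle gamma.
Proof.
move=> F sol kc; have [a [b gE]] := framed_solution F sol.
have k1E t : k1 t = 0.
  have dk := (sol t).1; rewrite -(is_derive_derive1 dk).
  have -> : k = cst c by apply/funext.
  exact: derive1_cst.
have c3 : c ^+ 3 = 2.
  have dk1 := (sol 0).2; have := is_derive_derive1 dk1.
  have -> : k1 = cst 0 by apply/funext.
  by rewrite derive1_cst kc; lra.
have c0 : 0 < c.
  by rewrite ltNge; apply/negP => c0; have := sqr_ge0 c; nra.
have r0 : 0 < c ^+ 2 / 2 by rewrite divr_gt0// exprn_gt0.
exists (a, b), (c ^+ 2 / 2); split => //.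
apply/seteqP; split => [_ [t _ <-]|p] /=.
  have [-> ->] := gE t; rewrite k1E kc /enorm /dot /=.
  have [_ _ _ _ uv] := F t.
  rewrite (_ : _ + _ = (c ^+ 2 / 2) ^+ 2 * (u t ^+ 2 + v t ^+ 2)); last by field.
  by rewrite uv mulr1 sqrtr_sqr gtr0_norm.
move=> pr.
have pE : (p.1 - a) ^+ 2 + (p.2 - b) ^+ 2 = (c ^+ 2 / 2) ^+ 2.
  rewrite -pr /enorm sqr_sqrtr /dot /= ?expr2//.
  by rewrite addr_ge0// -expr2 sqr_ge0.
have r00 : c ^+ 2 / 2 != 0 by rewrite gt_eqF.
have [al [cal sal]] : exists th, cos th = - (p.2 - b) / (c ^+ 2 / 2) /\
    sin th = (p.1 - a) / (c ^+ 2 / 2).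
  apply: ex_angle; move: (c ^+ 2 / 2) r00 pE => r r00 pE.
  rewrite !expr_div_n -mulrDl sqrrN addrC pE divff//.
  by rewrite expf_neq0.
have [th0 [cth sth]] : exists th, cos th = u 0 /\ sin th = v 0.
  by apply: ex_angle; have [] := F 0.
have dth (t : R) : is_derive t 1 (fun t => c * t + th0) (k t).
  by der; rewrite kc; ring.
have := framed_cos_sin F dth; rewrite mulr0 add0r => /(_ cth sth) uvE.
exists ((al - th0) / c) => //.
have [x1 x2] := gE ((al - th0) / c).
have [ue ve] := uvE ((al - th0) / c).
have tE : c * ((al - th0) / c) + th0 = al by field; rewrite gt_eqF.
rewrite tE in ue ve; rewrite [LHS]surjective_pairing [RHS]surjective_pairing.
rewrite x1 x2 k1E kc ue ve cal sal; congr pair.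
  by rewrite [_ / _ * _]mulrC divfK//; ring.
by rewrite [_ / _ * _]mulrC divfK//; ring.
Qed.

Lemma framed_bounds gamma k k1 u v P (m : nat) e : 0 < P ->
  framed gamma k u v -> is_solution k k1 -> periodic gamma P ->
  \int[mu]_(t in `[0, P]) (k t ^+ 2) = m%:R * period_energy e ->
  energy_area_bounds m P gamma.
Proof.
move=> P0 F sol gP Ek.
have EE : Num.sqrt (11 / 6) * m%:R * pi <= elastic_energy P gamma.
  rewrite /elastic_energy (framed_integral _ _ F) (framed_curvature F) Ek.
  by rewrite mulrAC mulrC ler_wpM2l// period_energy_ge.
split => //; first exact: framed_area P0 F sol gP.
have -> : Num.sqrt (11 / 96) = 4^-1 * Num.sqrt (11 / 6) :> R.
  rewrite (_ : 11 / 96 = 4^-1 ^+ 2 * (11 / 6)); last by field.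
  by rewrite sqrtrM ?sqr_ge0// sqrtr_sqr ger0_norm.
by rewrite -!mulrA ler_pM2l// mulrA.
Qed.

(* The tangential component of [tau'] vanishes because [|tau| = 1]. *)
Lemma arclength_frenet gamma t a b : arclength gamma ->
  is_derive t 1 (fun t => (dcurve gamma t).1) a ->
  is_derive t 1 (fun t => (dcurve gamma t).2) b ->
  a = - (curvature gamma t * (dcurve gamma t).2) /\
  b = curvature gamma t * (dcurve gamma t).1.
Proof.
move=> al du dv; have uv := dcurve_arclengthE al t.
have orth : (dcurve gamma t).1 * a + (dcurve gamma t).2 * b = 0.
  have d1 : is_derive t 1 (fun t => (dcurve gamma t).1 ^+ 2 +
      (dcurve gamma t).2 ^+ 2) (2 * ((dcurve gamma t).1 * a +
      (dcurve gamma t).2 * b)) by der; rewrite /=; ring.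
  have := is_derive_derive1 d1.
  rewrite (_ : (fun t => _ + _) = cst 1); last first.
    by apply/funext => x; exact: dcurve_arclengthE.
  by rewrite derive1_cst => /esym/eqP; rewrite mulf_eq0 pnatr_eq0/= => /eqP.
have -> : curvature gamma t = - a * (dcurve gamma t).2 + b * (dcurve gamma t).1.
  have dd : dcurve (dcurve gamma) t = (a, b).
    by rewrite {1}/dcurve (is_derive_derive1 du) (is_derive_derive1 dv).
  rewrite /curvature /normal /darc (tangent_arclength al) al dd /dot.
  by case: (dcurve gamma t) => u v /=; rewrite !divr1 mulrN mulNr.
move: (dcurve gamma t).1 (dcurve gamma t).2 uv orth => u v uv orth.
split; apply/eqP; rewrite -subr_eq0.
  rewrite (_ : _ - _ = a * (1 - (u ^+ 2 + v ^+ 2)) + u * (u * a + v * b)).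
    by rewrite uv orth subrr !mulr0 addr0.
  by ring.
rewrite (_ : _ - _ = b * (1 - (u ^+ 2 + v ^+ 2)) + v * (u * a + v * b)).
  by rewrite uv orth subrr !mulr0 addr0.
by ring.
Qed.

Lemma curvature_framed gamma k (u' v' : R -> R) : arclength gamma ->
  (forall t, derivable (fun t => (gamma t).1) t 1) ->
  (forall t, derivable (fun t => (gamma t).2) t 1) ->
  (forall t : R, is_derive t 1 (fun t => (dcurve gamma t).1) (u' t)) ->
  (forall t : R, is_derive t 1 (fun t => (dcurve gamma t).2) (v' t)) ->
  (forall t, curvature gamma t = k t) ->
  framed gamma k (fun t => (dcurve gamma t).1) (fun t => (dcurve gamma t).2).
Proof.
move=> al dx dy du dv kE t; have [uE vE] := arclength_frenet al (du t) (dv t).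
split; [exact: derivable_is_derive|exact: derivable_is_derive| | |].
- by rewrite -kE -uE; exact: du.
- by rewrite -kE -vE; exact: dv.
- exact: dcurve_arclengthE.
Qed.

End FramedCurves.

(** * Existence and uniqueness for each number of periods *)

Section SmoothCurves.
Context {R : realType}.
Implicit Types (gamma : R -> R * R) (kappa : R -> R) (e c t P : R).

Local Notation mu := (@lebesgue_measure R).

Lemma minimal_period_noncst (f : R -> R) T :
  is_minimal_period T f -> ~ exists c, forall t, f t = c.
Proof.
move=> [T0 _ minT] [c fc]; have : periodic f (T / 2) by move=> t; rewrite !fc.
have T2 : 0 < T / 2 by rewrite divr_gt0.
by move=> /(minT _ T2); lra.
Qed.

Lemma solution_with_curve_profile (m : nat) P kappa gamma : (2 <= m)%N ->
  solution_with_curve m P kappa gamma ->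
  exists e c, [/\ 0 < e, turning_angle e = 2 * pi / m%:R,
    forall t, kappa t = profile e (t + c) & energy_area_bounds m P gamma].
Proof.
move=> m2 [[sk eqk] kmin [sx sy gP al kE] wn].
have m0 : (0 < m)%N by exact: leq_trans m2.
have mR : 0 < m%:R :> R by rewrite ltr0n.
have P0 : 0 < P by have [+ _ _] := kmin; rewrite pmulr_lgt0// invr_gt0.
have sol : is_solution kappa (derive1 kappa).
  move=> t; split; first exact: smooth_is_derive.
  apply: is_derive1_eq (smooth_is_derive t (smooth_derive1 sk)) _.
  by have := eqk t; rewrite /derive1n /=; lra.
have F := curvature_framed al (fun t => ltac:(by have [] := smooth_is_derive t sx))
  (fun t => ltac:(by have [] := smooth_is_derive t sy))
  (fun t => smooth_is_derive t (smooth_derive1 sx))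
  (fun t => smooth_is_derive t (smooth_derive1 sy)) kE.
have kP : periodic kappa P.
  have [_ kPm _] := kmin; have := periodicM m kPm.
  by rewrite mulrC divfK ?gt_eqF.
have kint := framed_total_curvature F wn.
have [m' [e [c [[m'2 e0 eT kmin' kEp] kE2]]]] :=
  closed_solution P0 kP sol (minimal_period_noncst kmin) kint.
(* [closed_solution] chooses its own number of periods; uniqueness of the minimal period identifies
   it with the given one. *)
have mm' : m = m'.
  have /(mulfI (lt0r_neq0 P0))/invr_inj/eqP := minimal_period_uniq kmin kmin'.
  by rewrite eqr_nat => /eqP.
rewrite -{}mm' in eT kE2.
exists e, c; split=> //.
exact: (framed_bounds P0 F sol gP kE2).
Qed.

Lemma ex_solution_with_curve (m : nat) : (2 <= m)%N ->
  exists P kappa gamma, solution_with_curve m P kappa gamma.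
Proof.
move=> m2; have m0 : (0 < m)%N by exact: leq_trans m2.
have mR : m%:R != 0 :> R by rewrite pnatr_eq0 -lt0n.
have [e e0 eT] := @ex_turning_angle R m m2.
pose k := profile e; pose k1 := dprofile e; pose P := m%:R * period e.
have sol : is_solution k k1 := profile_solution e.
have dk t := (sol t).1; have dk1 t := (sol t).2.
have P0 : 0 < P by rewrite mulr_gt0 ?period_gt0// ltr0n.
have [th [th0 dth]] := ex_primitive (is_derive_cont dk).
pose u t := cos (th t); pose v t := sin (th t).
have du t : is_derive t 1 u (- (k t * v t)) by rewrite /u /v; der; ring.
have dv t : is_derive t 1 v (k t * u t) by rewrite /u /v; der; ring.
(* The curve is defined as [k' tau - k^2 / 2 nu] instead of by integrating the tangent; it is then
   periodic because [k], [k'] and the tangent are. *)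
pose x t := k1 t * u t + k t ^+ 2 / 2 * v t.
pose y t := k1 t * v t - k t ^+ 2 / 2 * u t.
have F : framed (fun t => (x t, y t)) k u v.
  move=> t; split => //=; last exact: cos2Dsin2.
  - by rewrite /x; der; rewrite /=; field.
  - by rewrite /y; der; rewrite /=; field.
have kP : periodic k P by exact: periodicM (@profile_periodic _ e).
have k1P : periodic k1 P.
  apply: periodicM => t.
  by rewrite /k1 /dprofile /quart phaseD (mulr_natl pi) cosD2pi sinD2pi.
have kint : \int[mu]_(t in `[0, P]) k t = 2 * pi.
  have := profile_integral e 0 m; rewrite eT.
  under eq_Rintegral do rewrite addr0.
  by move=> ->; field.
have thP t : th (t + P) = th t + pi *+ 2.
  rewrite (primitive_periodic dth kP).
  by rewrite -(Rintegral_FTC2 (ltW P0) (is_derive_cont dk) dth) kint mulr_natl.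
(* The derivatives of [k], [k1], [u] and [v] are polynomials in these four functions, and so are the
   coordinates of the curve. *)
have sG f : generated [set k; k1; u; v] f -> smooth f.
  apply: generated_smooth => {}f [[[]|]|] ->.
  - by exists k1 => //; apply: generated_gen; left; left; right.
  - exists (fun t => 1 + (- 2^-1) * k t ^+ 3); last first.
      by move=> t; apply: is_derive1_eq (dk1 t) _; rewrite mulNr.
    apply: generated_add; first exact: generated_cst.
    apply: generated_mul; first exact: generated_cst.
    by apply: generated_exp; apply: generated_gen; left; left; left.
  - exists (fun t => (- 1) * (k t * v t)); last first.
      by move=> t; apply: is_derive1_eq (du t) _; rewrite mulN1r.
    apply: generated_mul; first exact: generated_cst.
    by apply: generated_mul; apply: generated_gen; [left; left; left|right].
  - exists (fun t => k t * u t); last by [].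
    by apply: generated_mul; apply: generated_gen; [left; left; left|left; right].
have gk : generated [set k; k1; u; v] k by apply: generated_gen; left; left; left.
have gk1 : generated [set k; k1; u; v] k1 by apply: generated_gen; left; left; right.
have gu : generated [set k; k1; u; v] u by apply: generated_gen; left; right.
have gv : generated [set k; k1; u; v] v by apply: generated_gen; right.
have gk2 : generated [set k; k1; u; v] (fun t => k t ^+ 2 / 2).
  by apply: generated_mul (generated_cst _ _); exact: generated_exp.
exists P, k, (fun t => (x t, y t)); split.
- split => [|t]; first exact: sG.
  rewrite /derive1n /=.
  have -> : derive1 k = k1 by apply/funext => z; exact: is_derive_derive1.
  by rewrite (is_derive_derive1 (dk1 t)); lra.
- rewrite /has_m_periods /P mulrC mulKf ?mulfK//.
  exact: profile_minimal_period.
- split.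
  + by apply: sG; rewrite /x; apply: generated_add; apply: generated_mul.
  + apply: sG; rewrite (_ : (fun t => _) =
        fun t => k1 t * v t + (- 1) * (k t ^+ 2 / 2 * u t)).
      apply: generated_add; first exact: generated_mul.
      apply: generated_mul; first exact: generated_cst.
      exact: generated_mul.
    by apply/funext => t /=; rewrite /y mulN1r.
  + by move=> t; rewrite /x /y /u /v kP k1P thP cosD2pi sinD2pi.
  + exact: framed_arclength F.
  + by rewrite (framed_curvature F).
- rewrite /winding_number (framed_integral _ _ F) (framed_curvature F) kint.
  by rewrite mulVf// mulf_neq0 ?gt_eqF ?pi_gt0.
Qed.

Lemma solution_with_curve_unique (m : nat) P1 P2 kappa1 kappa2 gamma1 gamma2 :
  (2 <= m)%N -> solution_with_curve m P1 kappa1 gamma1 ->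
  solution_with_curve m P2 kappa2 gamma2 ->
  exists a : R, forall t, kappa2 t = kappa1 (t + a).
Proof.
move=> m2 /(solution_with_curve_profile m2)[e1 [c1 [e10 T1 k1E _]]].
move=> /(solution_with_curve_profile m2)[e2 [c2 [e20 T2 k2E _]]].
have e12 : e1 = e2.
  apply/eqP; rewrite eq_le; apply/andP; split; rewrite leNgt; apply/negP.
    by move=> /(turning_angle_lt (ltW e20)); rewrite T1 T2 ltxx.
  by move=> /(turning_angle_lt (ltW e10)); rewrite T1 T2 ltxx.
by exists (c2 - c1) => t; rewrite k2E k1E e12 -addrA subrK.
Qed.

End SmoothCurves.

(** * Integrals and test functions on a circle *)

Section SegmentIntegrals.
Context {R : realType}.
Implicit Types (f g h phi : R -> R) (a b c t x P : R).

Local Notation mu := (@lebesgue_measure R).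

Definition segL1 P f := mu.-integrable `[0, P] (EFin \o f).

Lemma cont_L1 P f : continuous f -> segL1 P f.
Proof. exact: cont_integrable. Qed.

Lemma within_L1 P f : {within `[0, P], continuous f} -> segL1 P f.
Proof. by apply: continuous_compact_integrable; exact: segment_compact. Qed.

Lemma L1D P f g : segL1 P f -> segL1 P g -> segL1 P (fun t => f t + g t).
Proof.
by move=> Lf Lg; exact: (@integrableD _ _ _ mu _ _ (EFin \o f) (EFin \o g)).
Qed.

Lemma L1B P f g : segL1 P f -> segL1 P g -> segL1 P (fun t => f t - g t).
Proof.
by move=> Lf Lg; exact: (@integrableB _ _ _ mu _ _ (EFin \o f) (EFin \o g)).
Qed.

Lemma L1Z P c f : segL1 P f -> segL1 P (fun t => c * f t).
Proof. by move=> Lf; exact: (@integrableZl _ _ _ mu _ _ c (EFin \o f)). Qed.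

Lemma L1_cst P c : segL1 P (fun=> c).
Proof. by apply: cont_L1; exact: cst_continuous. Qed.

Lemma within_bounded P f : 0 <= P -> {within `[0, P], continuous f} ->
  exists2 B, 0 <= B & forall t, 0 <= t <= P -> `|f t| <= B.
Proof.
move=> P0 cf; have [c _ cM] := @EVT_max R (fun t => `|f t|) 0 P P0 ltac:(
  move=> x; apply: continuous_comp; [exact: cf|exact: norm_continuous]).
by exists `|f c| => // t tP; apply: cM; rewrite in_itv.
Qed.

Lemma L1M P f phi : segL1 P f -> continuous phi -> segL1 P (fun t => f t * phi t).
Proof.
move=> Lf cphi.
apply: (@integrableMl _ _ _ mu _ _ (EFin \o f) phi) => //.
  by apply: measurable_funTS; exact: continuous_measurable_fun.
have [P0|P0] := leP 0 P.
  have [B _ cB] := within_bounded P0 (continuous_subspaceT cphi).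
  exists B; split; first exact: num_real.
  by move=> M BM t /=; rewrite in_itv => /cB /le_trans -> //; exact: ltW.
exists 0; split => // M _ t /=; rewrite in_itv/= => /andP[t0 tP].
by have := le_lt_trans (le_trans t0 tP) P0; rewrite ltxx.
Qed.

Lemma L1_sub P f t : segL1 P f -> t <= P -> mu.-integrable `[0, t] (EFin \o f).
Proof.
by move=> Lf tP; apply: integrableS Lf => //; apply: subset_itvl; rewrite bnd_simp.
Qed.

Lemma RintD P f g : segL1 P f -> segL1 P g ->
  \int[mu]_(t in `[0, P]) (f t + g t) =
  \int[mu]_(t in `[0, P]) f t + \int[mu]_(t in `[0, P]) g t.
Proof. by move=> Lf Lg; rewrite RintegralD. Qed.

Lemma RintB P f g : segL1 P f -> segL1 P g ->
  \int[mu]_(t in `[0, P]) (f t - g t) =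
  \int[mu]_(t in `[0, P]) f t - \int[mu]_(t in `[0, P]) g t.
Proof. by move=> Lf Lg; rewrite RintegralB. Qed.

Lemma RintZ P c f : segL1 P f ->
  \int[mu]_(t in `[0, P]) (c * f t) = c * \int[mu]_(t in `[0, P]) f t.
Proof. by move=> Lf; rewrite RintegralZl. Qed.

Lemma Rint_cst P c : 0 <= P -> \int[mu]_(t in `[0, P]) c = c * P.
Proof.
move=> P0; have dc t : is_derive t 1 ( *%R c) c by exact: derive_mull.
by rewrite (Rintegral_FTC2 P0 (@cst_continuous _ _ c) dc) mulr0 subr0.
Qed.

Lemma le_Rint P f g : segL1 P f -> segL1 P g ->
  (forall t, 0 <= t <= P -> f t <= g t) ->
  \int[mu]_(t in `[0, P]) f t <= \int[mu]_(t in `[0, P]) g t.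
Proof.
by move=> Lf Lg fg; apply: le_Rintegral => // t; rewrite /= in_itv; exact: fg.
Qed.

Lemma within_interior P f t : {within `[0, P], continuous f} -> 0 < t < P ->
  {for t, continuous f}.
Proof.
move=> cf tP; have P0 : 0 < P by case/andP: tP; exact: lt_trans.
by have [/(_ t) + _ _] := (continuous_within_itvP f P0).1 cf; apply; rewrite in_itv.
Qed.

Lemma within_closed P f c : 0 < P -> {within `[0, P], continuous f} ->
  (forall t, 0 < t < P -> f t = c) -> forall t, 0 <= t <= P -> f t = c.
Proof.
move=> P0 cf fc t /andP[]; have [_ c0 cP] := (continuous_within_itvP f P0).1 cf.
rewrite le_eqVlt => /predU1P[<-|t0].
  move=> _; apply: (cvg_unique _ c0) => //.
  apply: cvg_near_cst; near=> x; apply: fc.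
  by apply/andP; split; near: x; [exact: nbhs_right_gt|exact: nbhs_right_lt].
rewrite le_eqVlt => /predU1P[->|tP]; last by rewrite fc// t0.
apply: (cvg_unique _ cP) => //.
apply: cvg_near_cst; near=> x; apply: fc.
by apply/andP; split; near: x; [exact: nbhs_left_gt|exact: nbhs_left_lt].
Unshelve. all: end_near. Qed.

End SegmentIntegrals.

(** * The fundamental lemma with periodic test functions *)

Section TestFunctions.
Context {R : realType}.
Implicit Types (f g h phi psi : R -> R) (a b c t x P : R).

Local Notation mu := (@lebesgue_measure R).

Lemma smooth_cont f : smooth f -> continuous f.
Proof. by move=> /(_ 0%N) df; apply: derivable_cont. Qed.

Lemma smooth_cst c : smooth (fun _ : R => c).
Proof. by apply: (@generated_smooth R set0) => //; exact: generated_cst. Qed.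

Lemma smooth_primitive f g : (forall t : R, is_derive t 1 f (g t)) -> smooth g ->
  smooth f.
Proof.
move=> dfg sg [|n] t; first by have [] := dfg t.
rewrite /derive1n iterSr (_ : derive1 f = g); first exact: sg.
by apply/funext => x; exact: is_derive_derive1.
Qed.

Lemma smoothB_cst f c : smooth f -> smooth (fun t => f t - c).
Proof.
move=> sf; apply: (@smooth_primitive _ (derive1 f)); last exact: smooth_derive1.
by move=> t; have df := smooth_is_derive t sf; der; ring.
Qed.

Lemma periodic_derive1 f P : (forall t, derivable f t 1) -> periodic f P ->
  periodic (derive1 f) P.
Proof.
move=> df fP t.
have d1 : is_derive t 1 (fun t => f (t + P)) (derive1 f (t + P)).
  by dercomp (fun t => derivable_is_derive (df t)); ring.
rewrite -(is_derive_derive1 d1); congr (derive1 _ _).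
by apply/funext => x; rewrite fP.
Qed.

(** The primitive is normalized to mean zero so that the lemma applies to it again; two applications
    give second primitives. *)
Lemma test_primitive P psi : 0 < P -> smooth psi -> periodic psi P ->
  \int[mu]_(t in `[0, P]) psi t = 0 ->
  exists phi, [/\ smooth phi, periodic phi P, derive1 phi = psi &
    \int[mu]_(t in `[0, P]) phi t = 0].
Proof.
move=> P0 spsi psiP psi0; have cpsi := smooth_cont spsi.
have [F [F0 dF]] := ex_primitive cpsi.
have cF : continuous F := is_derive_cont dF.
pose c := (\int[mu]_(t in `[0, P]) F t) / P.
have dF' t : is_derive t 1 (fun t => F t - c) (psi t) by der; ring.
exists (fun t => F t - c); split.
- exact: smooth_primitive dF' spsi.
- move=> t; rewrite (primitive_periodic dF psiP).
  by rewrite -(Rintegral_FTC2 (ltW P0) cpsi dF) psi0 addr0.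
- by apply/funext => t; exact: is_derive_derive1.
- rewrite (RintB (cont_L1 P cF) (L1_cst P c)).
  by rewrite Rint_cst ?(ltW P0)// /c divfK ?subrr// gt_eqF.
Qed.

(** This is [cos^2 (pi (t - x) / P)]: smooth and periodic, with values in [[0, 1]] and maximum 1 at
    [x]. Its powers serve as bump functions on the circle. *)
Let kernel P x t : R := (1 + cos (2 * pi / P * (t - x))) / 2.

Let kernel_smooth P x n : smooth (fun t => kernel P x t ^+ n).
Proof.
pose C t : R := cos (2 * pi / P * (t - x)); pose S t : R := sin (2 * pi / P * (t - x)).
apply: (@generated_smooth R [set C; S]).
  move=> f [|] ->.
    exists (fun t => (- (2 * pi / P)) * S t).
      apply: generated_mul; first exact: generated_cst.
      by apply: generated_gen; right.
    by move=> t; rewrite /C /S; der; ring.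
  exists (fun t => (2 * pi / P) * C t).
    apply: generated_mul; first exact: generated_cst.
    by apply: generated_gen; left.
  by move=> t; rewrite /C /S; der; ring.
apply: generated_exp; rewrite /kernel.
apply: generated_mul (generated_cst _ _).
apply: generated_add; first exact: generated_cst.
by apply: generated_gen; left.
Qed.

Let kernel_periodic P x n : 0 < P -> periodic (fun t => kernel P x t ^+ n) P.
Proof.
move=> P0 t; congr (_ ^+ n); rewrite /kernel.
rewrite (_ : 2 * pi / P * (t + P - x) = 2 * pi / P * (t - x) + pi *+ 2) ?cosD2pi//.
by rewrite -mulr_natl; field; rewrite gt_eqF.
Qed.

Let kernel_ge0 P x t : 0 <= kernel P x t.
Proof. by rewrite divr_ge0//; have := cos_geN1 (2 * pi / P * (t - x)); lra. Qed.

Let kernel_norm P x t : kernel P x t = (1 + cos (2 * pi / P * `|t - x|)) / 2.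
Proof.
rewrite /kernel; congr ((1 + _) / 2).
by case: ger0P => // _; rewrite mulrN cosN.
Qed.

Let cos_le x t : 0 <= x -> x <= t -> t <= pi -> cos t <= cos x.
Proof.
by move=> x0 xt tpi; rewrite leNgt ltr_cos ?in_itv/= -?leNgt//; lra.
Qed.

Let kernel_le P x d t : 0 < P -> 0 <= d <= P / 2 -> d <= `|t - x| <= P - d ->
  kernel P x t <= (1 + cos (2 * pi / P * d)) / 2.
Proof.
move=> P0 /andP[d0 dP] /andP[dt tP]; rewrite kernel_norm ler_pM2r// lerD2l.
have pi0 := pi_gt0 R.
have w0 : 0 < 2 * pi / P by rewrite divr_gt0// mulr_gt0.
have wP : 2 * pi / P * P = 2 * pi by rewrite divfK// gt_eqF.
have w2 : 2 * pi / P * (P / 2) = pi by field; rewrite gt_eqF.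
have [tP2|tP2] := leP `|t - x| (P / 2).
  apply: cos_le; rewrite ?ler_pM2l//; first by rewrite mulr_ge0// ltW.
  by rewrite -[leRHS]w2 ler_pM2l.
have -> : cos (2 * pi / P * `|t - x|) = cos (2 * pi / P * (P - `|t - x|)).
  by rewrite -[RHS]cosN -[RHS]cosD2pi mulrBr wP; congr cos; ring.
apply: cos_le; rewrite ?ler_pM2l//.
- by rewrite mulr_ge0// ltW.
- by lra.
- by rewrite -[leRHS]w2 ler_pM2l//; lra.
Qed.

Let kernel_ge P x d t : 0 < P -> 0 <= d <= P / 2 -> `|t - x| <= d ->
  (1 + cos (2 * pi / P * d)) / 2 <= kernel P x t.
Proof.
move=> P0 /andP[d0 dP] td; rewrite kernel_norm ler_pM2r// lerD2l.
have w0 : 0 < 2 * pi / P by rewrite divr_gt0// mulr_gt0// pi_gt0.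
have w2 : 2 * pi / P * (P / 2) = pi by field; rewrite gt_eqF.
apply: cos_le; rewrite ?ler_pM2l//; first by rewrite mulr_ge0// ltW.
by rewrite -[leRHS]w2 ler_pM2l.
Qed.

(* If [h x > 0], the powers of the kernel concentrate at [x]: outside of a
   neighbourhood where [h > h x / 2] they are exponentially smaller than near
   [x], so the integral of [h] against a high power is positive. *)
Let test_orthogonal_le0 P h x : {within `[0, P], continuous h} ->
  (forall phi, smooth phi -> periodic phi P ->
    \int[mu]_(t in `[0, P]) (h t * phi t) = 0) ->
  0 < x < P -> h x <= 0.
Proof.
move=> ch h0 /andP[x0 xP]; rewrite leNgt; apply/negP => hx.
have P0 : 0 < P := lt_trans x0 xP.
pose M := h x / 2; have M0 : 0 < M by rewrite divr_gt0.
have [d0 d00 hd0] : exists2 d0, 0 < d0 & forall t, `|t - x| < d0 -> M < h t.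
  have cx : {for x, continuous h} by apply: within_interior ch _; rewrite x0.
  have Mh : M < h x by rewrite /M; lra.
  have [d0 /= d00 H] := cvgr_gt _ cx _ Mh.
  by exists d0 => // t tx; apply: H; rewrite /= distrC.
pose d := Num.min (d0 / 2) (Num.min (x / 2) ((P - x) / 2)).
have dd : [/\ 0 < d, d < d0, 2 * d <= x & 2 * d <= P - x].
  have h1 : 0 < d by rewrite !lt_min; apply/and3P; split; lra.
  have : d <= d0 / 2 by rewrite ge_min lexx.
  have : d <= x / 2 by rewrite !ge_min lexx orbT.
  have : d <= (P - x) / 2 by rewrite !ge_min lexx !orbT.
  by move=> ? ? ?; split => //; lra.
case: dd => d_gt0 dd0 dx dPx.
have dP2 : 0 <= d <= P / 2 by apply/andP; split; lra.
have d2P2 : 0 <= d / 2 <= P / 2 by apply/andP; split; lra.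
have [B B0 hB] := within_bounded (ltW P0) ch.
pose r := (1 + cos (2 * pi / P * d)) / 2.
pose r' := (1 + cos (2 * pi / P * (d / 2))) / 2.
have r0 : 0 <= r by rewrite divr_ge0//; have := cos_geN1 (2 * pi / P * d); lra.
have rr' : r < r'.
  have w0 : 0 < 2 * pi / P by rewrite divr_gt0// mulr_gt0// pi_gt0.
  have w2 : 2 * pi / P * (P / 2) = pi by field; rewrite gt_eqF.
  have wd : 2 * pi / P * d <= pi by rewrite -[leRHS]w2 ler_pM2l//; lra.
  have wd2 : 2 * pi / P * (d / 2) < 2 * pi / P * d by rewrite ltr_pM2l//; lra.
  have wd0 : 0 <= 2 * pi / P * (d / 2) by rewrite mulr_ge0 ?(ltW w0)//; lra.
  by rewrite /r /r' ltr_pM2r// ltrD2l ltr_cos ?in_itv//=; lra.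
have r'0 : 0 < r' by exact: le_lt_trans rr'.
have key (n : nat) : M * d * r' ^+ n <= (M + B) * P * r ^+ n.
  have ck : continuous (fun t => kernel P x t ^+ n) := smooth_cont (@kernel_smooth P x n).
  (* Pointwise: within distance [d] of [x], [h] exceeds [M]; elsewhere [h >= - B] and the kernel is
     at most [r]. The right-hand integral vanishes by hypothesis, while the integral of the power is
     at least [d r'^n], which contradicts [r < r'] for large [n]. *)
  have H : \int[mu]_(t in `[0, P]) (M * kernel P x t ^+ n - (M + B) * r ^+ n) <=
      \int[mu]_(t in `[0, P]) (h t * kernel P x t ^+ n).
    apply: le_Rint.
    - by apply: L1B; [exact/L1Z/cont_L1|exact: L1_cst].
    - by apply: L1M => //; exact: within_L1.
    move=> t tP; have kn0 : 0 <= kernel P x t ^+ n by rewrite exprn_ge0.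
    have rn0 : 0 <= (M + B) * r ^+ n by rewrite mulr_ge0 ?exprn_ge0//; lra.
    have [td|td] := ltP `|t - x| d.
      by have := ler_wpM2r kn0 (ltW (hd0 _ (lt_trans td dd0))); lra.
    have kr : kernel P x t ^+ n <= r ^+ n.
      apply: lerXn2r; rewrite ?nnegrE//; apply: kernel_le => //.
      rewrite td /=; move: tP => /andP[t0 tP].
      by rewrite ler_norml; apply/andP; split; lra.
    have : - B <= h t by have := hB _ tP; rewrite ler_norml => /andP[].
    move=> /(ler_wpM2r kn0); have := ler_wpM2l (ltW M0) kr.
    by have := ler_wpM2l B0 kr; lra.
  rewrite h0 in H; [|exact: kernel_smooth|exact: kernel_periodic].
  have [W [W0 dW]] := ex_primitive ck.
  have I : d * r' ^+ n <= \int[mu]_(t in `[0, P]) kernel P x t ^+ n.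
    rewrite (Rintegral_FTC2 (ltW P0) ck dW).
    have xd : x - d / 2 <= x + d / 2 by lra.
    have [c /andP[c1 c2] cE] := is_derive_mvt xd dW.
    have kn0 t : 0 <= kernel P x t ^+ n by rewrite exprn_ge0.
    have h1 : W 0 <= W (x - d / 2) by apply: (is_derive_ge0_le dW kn0); lra.
    have h2 : W (x + d / 2) <= W P by apply: (is_derive_ge0_le dW kn0); lra.
    have : r' ^+ n <= kernel P x c ^+ n.
      apply: lerXn2r; rewrite ?nnegrE ?(ltW r'0)//; apply: kernel_ge => //.
      by rewrite ler_norml; apply/andP; split; lra.
    by move=> /(ler_wpM2r (ltW d_gt0)); lra.
  move: H; rewrite (RintB (L1Z M (cont_L1 P ck)) (L1_cst _ _)).
  rewrite (RintZ _ (cont_L1 P ck)) Rint_cst ?(ltW P0)// => H.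
  by have := ler_wpM2l (ltW M0) I; lra.
have q1 : `|r / r'| < 1.
  by rewrite ger0_norm ?divr_ge0 ?(ltW r'0)// ltr_pdivrMr// mul1r.
have C0 : 0 < M * d / ((M + B) * P).
  by rewrite divr_gt0 ?mulr_gt0//; lra.
have [n _ Hn] := cvgr_lt _ (cvg_expr q1) _ C0.
have := Hn n (leqnn n); rewrite /= ltr_pdivlMr ?mulr_gt0//; last lra.
rewrite expr_div_n mulrAC ltr_pdivrMr ?exprn_gt0//.
by have := key n; lra.
Qed.

Lemma test_orthogonal_eq0 P h : {within `[0, P], continuous h} ->
  (forall phi, smooth phi -> periodic phi P ->
    \int[mu]_(t in `[0, P]) (h t * phi t) = 0) ->
  forall t, 0 < t < P -> h t = 0.
Proof.
move=> ch h0 t tP; apply/eqP; rewrite eq_le; apply/andP; split.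
  exact: test_orthogonal_le0 ch h0 tP.
have cN : {within `[0, P], continuous (fun t => - h t)}.
  by move=> x; apply: continuousN; exact: ch.
rewrite -oppr_le0; apply: (@test_orthogonal_le0 P (fun t => - h t)) => // phi sphi phiP.
under eq_Rintegral do rewrite mulNr -mulN1r.
rewrite RintZ ?h0 ?mulr0//; apply: L1M (smooth_cont sphi); exact: within_L1.
Qed.

End TestFunctions.

(** * Weak derivatives and primitives of integrable functions *)

Section WeakDerivatives.
Context {R : realType}.
Implicit Types (f g h d q phi psi : R -> R) (a b c t x P : R).

Local Notation mu := (@lebesgue_measure R).

Definition prim f x := \int[mu]_(t in `[0, x]) f t.

Lemma prim0 f : prim f 0 = 0.
Proof. by rewrite /prim set_itv1 Rintegral_set1. Qed.

Lemma prim_continuous P f : 0 <= P -> segL1 P f ->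
  {within `[0, P], continuous (prim f)}.
Proof. exact: parameterized_integral_continuous. Qed.

Lemma prim_L1 P f : 0 <= P -> segL1 P f -> segL1 P (prim f).
Proof. by move=> P0 Lf; apply: within_L1; exact: prim_continuous. Qed.

Lemma eq_prim f g x : (forall t, 0 <= t <= x -> f t = g t) -> prim f x = prim g x.
Proof.
move=> fg; apply: eq_Rintegral => t; rewrite inE /= in_itv/=; exact: fg.
Qed.

Lemma Rint_norm_le P f : segL1 P f ->
  `|\int[mu]_(t in `[0, P]) f t| <= \int[mu]_(t in `[0, P]) `|f t|.
Proof. by move=> Lf; apply: le_normr_Rintegral. Qed.

Lemma L1_norm P f : segL1 P f -> segL1 P (fun t => `|f t|).
Proof. by move=> Lf; exact: integrable_norm. Qed.

Lemma L1_approx P f e : segL1 P f -> 0 < e ->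
  exists2 g, continuous g & \int[mu]_(t in `[0, P]) `|f t - g t| < e.
Proof.
move=> Lf e0; have mI : measurable (`[0, P]%classic : set (measurableTypeR R)) by [].
have Ioo : (mu `[0%R, P]%classic < +oo)%E.
  by rewrite lebesgue_measure_itv/=; case: ifPn => _; rewrite ?ltry// -EFinD ltry.
have [g_ [cg _ /fine_cvgP[_ g0]]] := approximation_continuous_integrable mI Ioo Lf.
have [n _ Hn] := cvgr_lt _ g0 _ e0.
exists (g_ n); first exact: cg.
exact: Hn n (leqnn n).
Qed.

(* The two sides are [L^1]-continuous in [h], and continuous functions are
   dense. *)
Lemma L1_by_parts P h phi : 0 < P -> segL1 P h -> smooth phi ->
  \int[mu]_(t in `[0, P]) (h t * phi t) =
  prim h P * phi P - \int[mu]_(t in `[0, P]) (prim h t * derive1 phi t).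
Proof.
move=> P0 Lh sphi; have cphi := smooth_cont sphi.
have cdphi := smooth_cont (smooth_derive1 sphi).
have [B B0 hB] := within_bounded (ltW P0) (continuous_subspaceT cphi).
have [B' B'0 hB'] := within_bounded (ltW P0) (continuous_subspaceT cdphi).
have LH := prim_L1 (ltW P0) Lh.
suff H e : 0 < e -> `|\int[mu]_(t in `[0, P]) (h t * phi t) - (prim h P * phi P -
    \int[mu]_(t in `[0, P]) (prim h t * derive1 phi t))| <= e * (2 * B + B' * P).
  apply/eqP; rewrite -subr_eq0 -normr_le0 leNgt; apply/negP => N0.
  set N := `|_| in H N0.
  have K0 : 0 < 2 * (2 * B + B' * P + 1).
    by rewrite mulr_gt0// ltr_wpDl// addr_ge0 ?mulr_ge0// ltW.
  have := H (N / (2 * (2 * B + B' * P + 1))) (divr_gt0 N0 K0).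
  rewrite mulrAC ler_pdivlMr//.
  have : 0 <= 2 * B + B' * P by rewrite addr_ge0 ?mulr_ge0// ltW.
  by nra.
move=> e0; have [g cg hg] := L1_approx Lh e0.
have [G [G0 dG]] := ex_primitive cg.
have cG : continuous G := is_derive_cont dG.
have Lg := cont_L1 P cg; have Lhg := L1B Lh Lg.
have GE t : 0 <= t -> prim g t = G t.
  by move=> t0; rewrite /prim (Rintegral_FTC2 t0 cg dG) G0 subr0.
have gE : \int[mu]_(t in `[0, P]) (g t * phi t) =
    G P * phi P - \int[mu]_(t in `[0, P]) (G t * derive1 phi t).
  have dGp t : is_derive t 1 (fun t => G t * phi t) (g t * phi t + G t * derive1 phi t).
    by have dphi := smooth_is_derive t sphi; der.
  have := Rintegral_FTC2 (ltW P0) _ dGp.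
  rewrite (RintD (L1M Lg cphi) (L1M (cont_L1 P cG) cdphi)) G0 mul0r subr0 => <-.
    by rewrite addrK.
  have dphi t := smooth_is_derive t sphi.
  move=> t; apply: cvgD; apply: cvgM; [exact: cg|exact: cphi|exact: cG|exact: cdphi].
have HG t : 0 <= t <= P -> `|prim h t - G t| <= e.
  move=> /andP[t0 tP]; rewrite -GE// /prim.
  have Lht : segL1 t h := L1_sub Lh tP.
  rewrite -(RintB Lht (cont_L1 t cg)).
  apply: (le_trans (Rint_norm_le (L1B Lht (cont_L1 t cg)))).
  apply: ltW; apply: le_lt_trans hg.
  rewrite (Rintegral_Chasles (L1_norm Lhg) t0 tP) lerDl.
  by apply: Rintegral_ge0.
have E1 : `|\int[mu]_(t in `[0, P]) (h t * phi t) -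
    \int[mu]_(t in `[0, P]) (g t * phi t)| <= e * B.
  rewrite -(RintB (L1M Lh cphi) (L1M Lg cphi)).
  apply: (le_trans (Rint_norm_le (L1B (L1M Lh cphi) (L1M Lg cphi)))).
  apply: (@le_trans _ _ (\int[mu]_(t in `[0, P]) (B * `|h t - g t|))).
    apply: le_Rint.
    - exact: L1_norm (L1B (L1M Lh cphi) (L1M Lg cphi)).
    - exact: L1Z (L1_norm Lhg).
    by move=> t tP; rewrite -mulrBl normrM mulrC ler_wpM2r// hB.
  by rewrite (RintZ _ (L1_norm Lhg)) mulrC ler_wpM2r// ltW.
have LHG := L1B (L1M LH cdphi) (L1M (cont_L1 P cG) cdphi).
have E2 : `|\int[mu]_(t in `[0, P]) (prim h t * derive1 phi t) -
    \int[mu]_(t in `[0, P]) (G t * derive1 phi t)| <= e * (B' * P).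
  rewrite -(RintB (L1M LH cdphi) (L1M (cont_L1 P cG) cdphi)).
  apply: (le_trans (Rint_norm_le LHG)).
  apply: (@le_trans _ _ (\int[mu]_(t in `[0, P]) (e * B'))).
    apply: le_Rint; [exact: L1_norm|exact: L1_cst|].
    by move=> t tP; rewrite -mulrBl normrM ler_pM// ?HG ?hB'.
  by rewrite Rint_cst ?mulrA// ltW.
have E3 : `|(prim h P - G P) * phi P| <= e * B.
  by rewrite normrM ler_pM ?HG ?hB ?lexx ?(ltW P0).
move: E1 E2 E3; rewrite gE !ler_norml => /andP[? ?] /andP[? ?] /andP[? ?].
by apply/andP; split; lra.
Qed.

Lemma periodic0P f P : periodic f P -> f P = f 0.
Proof. by move=> fP; have := fP 0; rewrite add0r. Qed.

(** The du Bois-Reymond lemma. The fundamental lemma wants a continuous function, so it is applied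
    to the primitive of [h] minus its mean: integration by parts makes that primitive orthogonal to
    second derivatives, hence to every test function of mean zero. It is thus constant, and zero
    since it starts at 0. *)
Lemma weak_derivative0 P h : 0 < P -> segL1 P h ->
  (forall phi, smooth phi -> periodic phi P ->
    \int[mu]_(t in `[0, P]) (h t * derive1 phi t) = 0) ->
  exists c, forall t, 0 <= t <= P -> prim h t = c * t.
Proof.
move=> P0 Lh h0; pose c := prim h P / P; exists c.
have P00 : P != 0 by rewrite gt_eqF.
pose h1 t := h t - c; have Lh1 : segL1 P h1 by exact: L1B Lh (L1_cst _ _).
have H1E t : 0 <= t <= P -> prim h1 t = prim h t - c * t.
  move=> /andP[t0 tP].
  by rewrite /prim (RintB (L1_sub Lh tP : segL1 t h) (L1_cst t c)) Rint_cst.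
have PP : 0 <= P <= P by rewrite lexx ltW.
have H1P : prim h1 P = 0 by rewrite H1E// /c divfK ?subrr.
have LH1 := prim_L1 (ltW P0) Lh1.
have orth phi : smooth phi -> periodic phi P ->
    \int[mu]_(t in `[0, P]) (prim h1 t * derive1 (derive1 phi) t) = 0.
  move=> sphi phiP; have sd := smooth_derive1 sphi.
  have := L1_by_parts P0 Lh1 sd; rewrite H1P mul0r sub0r => /eqP.
  rewrite eq_sym eqr_oppLR => /eqP ->; apply/eqP; rewrite oppr_eq0; apply/eqP.
  have cd := smooth_cont sd.
  under eq_Rintegral do rewrite mulrBl.
  rewrite (RintB (L1M Lh cd) (L1Z c (cont_L1 P cd))) h0// (RintZ _ (cont_L1 P cd)).
  rewrite (Rintegral_FTC2 (ltW P0) cd (fun t => smooth_is_derive t sphi)).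
  by rewrite (periodic0P phiP) subrr mulr0 subrr.
pose a := (\int[mu]_(t in `[0, P]) prim h1 t) / P.
have cH1 := prim_continuous (ltW P0) Lh1.
have ca : {within `[0, P], continuous (fun t => prim h1 t - a)}.
  by move=> x; apply: continuousB; [exact: cH1|exact: cst_continuous].
have H1a : forall t, 0 < t < P -> prim h1 t - a = 0.
  apply: test_orthogonal_eq0 => // psi spsi psiP.
  have cpsi := smooth_cont spsi; have Lpsi := cont_L1 P cpsi.
  pose m := (\int[mu]_(t in `[0, P]) psi t) / P.
  have s1 : smooth (fun t => psi t - m) by exact: smoothB_cst.
  have p1 : periodic (fun t => psi t - m) P by move=> t; rewrite psiP.
  have z1 : \int[mu]_(t in `[0, P]) (psi t - m) = 0.
    by rewrite (RintB Lpsi (L1_cst P m)) Rint_cst ?(ltW P0)// /m divfK ?subrr.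
  have [phi1 [sphi1 pphi1 dphi1 zphi1]] := test_primitive P0 s1 p1 z1.
  have [phi2 [sphi2 pphi2 dphi2 _]] := test_primitive P0 sphi1 pphi1 zphi1.
  have := orth _ sphi2 pphi2; rewrite dphi2 dphi1.
  under eq_Rintegral do rewrite mulrBr (mulrC _ m).
  rewrite (RintB (L1M LH1 cpsi) (L1Z m LH1)) (RintZ _ LH1) => z2.
  under eq_Rintegral do rewrite mulrBl.
  rewrite (RintB (L1M LH1 cpsi) (L1Z a Lpsi)) (RintZ _ Lpsi).
  have -> : a * \int[mu]_(t in `[0, P]) psi t =
            m * \int[mu]_(t in `[0, P]) prim h1 t by rewrite /a /m; ring.
  exact: z2.
have cl := within_closed P0 ca H1a.
have a0 : a = 0.
  by have := cl 0; rewrite prim0 lexx ltW// => /(_ isT); lra.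
by move=> t tP; have := cl t tP; rewrite H1E// a0; lra.
Qed.

Lemma weak_derivative_prim P f g : 0 < P -> segL1 P f -> segL1 P g ->
  weak_derivative P f g -> prim g P = 0 /\
  exists c, forall t, 0 <= t <= P -> prim f t = prim (fun x => c + prim g x) t.
Proof.
move=> P0 Lf Lg wd.
have gP : prim g P = 0.
  have := wd _ (@smooth_cst R 1) (fun _ => erefl).
  under eq_Rintegral do rewrite derive1_cst mulr0.
  rewrite Rint_cst ?(ltW P0)// mul0r => /esym/eqP; rewrite oppr_eq0 => /eqP.
  by under eq_Rintegral do rewrite mulr1.
split => //; have LG := prim_L1 (ltW P0) Lg.
have [|c cE] := @weak_derivative0 P (fun t => f t - prim g t) P0 (L1B Lf LG).
  move=> phi sphi phiP; have cd := smooth_cont (smooth_derive1 sphi).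
  under eq_Rintegral do rewrite mulrBl.
  rewrite (RintB (L1M Lf cd) (L1M LG cd)) wd// (L1_by_parts P0 Lg sphi) gP.
  by ring.
exists c => t tP; have := cE t tP; move/andP: tP => [t0 tP].
have Lft : segL1 t f := L1_sub Lf tP.
have LGt : segL1 t (prim g) := L1_sub LG tP.
rewrite /prim (RintB Lft LGt) (RintD (L1_cst t c) LGt) Rint_cst//.
by lra.
Qed.

Lemma ae_imp (A B : set R) : {ae mu, forall t, A t} -> (forall t, A t -> B t) ->
  {ae mu, forall t, B t}.
Proof.
by move=> aeA AB; apply: filterS aeA => //; exact: (ae_filter_ringOfSetsType mu).
Qed.

Lemma prim_derivable_ae P g : segL1 P g ->
  {ae mu, forall t, 0 < t < P -> is_derive t 1 (prim g) (g t)}.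
Proof.
(* Extension by zero gives a function integrable on the whole line, to which Lebesgue
   differentiation applies; near an interior point the primitive is unchanged. *)
move=> Lg; pose gP := g \_ `[0, P].
have iT : mu.-integrable [set: R] (EFin \o gP).
  by rewrite /gP -restrict_EFin; apply/integrable_restrict => //; rewrite setTI.
have iy y : mu.-integrable `[0, y] (EFin \o gP).
  exact: integrableS iT.
have lT : locally_integrable [set: R] gP.
  by apply: integrable_locally.
have := @FTC1 R gP (BLeft 0) iy lT.
move=> /ae_imp; apply => t H /andP[t0 tP].
have [] := H; first by rewrite /= lte_fin.
move=> /derivable_is_derive dF FE; rewrite FE in dF.
have gt : gP t = g t.
  by rewrite /gP patchE mem_set//= in_itv/= !ltW.
rewrite gt in dF; apply: near_eq_is_derive dF.
near=> x; apply: eq_prim => z /andP[z0 zx].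
rewrite /gP patchE mem_set//= in_itv/= z0 (le_trans zx)// ltW//.
by near: x; exact: lt_nbhsl.
Unshelve. all: end_near. Qed.

Lemma prim0_ae P d : segL1 P d -> (forall t, 0 <= t <= P -> prim d t = 0) ->
  {ae mu, forall t, 0 < t < P -> d t = 0}.
Proof.
move=> Ld d0; apply: (ae_imp (prim_derivable_ae Ld)) => t H tP.
have d1 := H tP; case/andP: tP => t0 tP.
have d2 : is_derive t 1 (prim d) 0.
  apply: near_eq_is_derive (deriveC t 0); near=> x.
  rewrite d0//; apply/andP; split; apply: ltW; near: x.
    exact: lt_nbhsr.
  exact: lt_nbhsl.
by rewrite -(is_derive_derive1 d1) (is_derive_derive1 d2).
Unshelve. all: end_near. Qed.

Lemma ae_prim_eq P f g : segL1 P f -> segL1 P g ->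
  {ae mu, forall t, 0 < t < P -> f t = g t} ->
  forall t, 0 <= t <= P -> prim f t = prim g t.
Proof.
move=> Lf Lg fg t /andP[t0 tP].
have Lft : segL1 t f := L1_sub Lf tP.
have Lgt : segL1 t g := L1_sub Lg tP.
have [->|tn0] := eqVneq t 0; first by rewrite !prim0.
have t0' : 0 < t by rewrite lt_def tn0.
have E h : segL1 t h -> prim h t = \int[mu]_(x in `]0, t[) h x.
  move=> Lh; rewrite Rintegral_itv_bndo_bndc.
    rewrite Rintegral_itv_obnd_cbnd//.
    by apply: integrableS Lh => //; exact: subset_itv_oc_cc.
  by apply: integrableS Lh => //; exact: subset_itv_oo_cc.
rewrite !E//; congr fine; apply: ae_eq_integral => //.
- apply: (measurable_int mu); apply: integrableS Lft => //.
  exact: subset_itv_oo_cc.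
- apply: (measurable_int mu); apply: integrableS Lgt => //.
  exact: subset_itv_oo_cc.
- apply: (ae_imp fg) => x H; rewrite /= in_itv/= => /andP[x0 xt].
  by rewrite H// x0 (lt_le_trans xt).
Qed.

Lemma prim_eq_interior P f g : {within `[0, P], continuous f} ->
  {within `[0, P], continuous g} ->
  (forall t, 0 <= t <= P -> prim f t = prim g t) ->
  forall t, 0 < t < P -> f t = g t.
Proof.
move=> cf cg fg t /andP[t0 tP].
have der h : {within `[0, P], continuous h} -> is_derive t 1 (prim h) (h t).
  move=> ch; have [] := @continuous_FTC1_closed R h 0 t P tP (within_L1 ch) t0.
    by apply: within_interior ch _; rewrite t0.
  by move=> /derivable_is_derive + <-.
rewrite -(is_derive_derive1 (der f cf)).
apply: is_derive_derive1; apply: near_eq_is_derive (der g cg); near=> x.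
rewrite fg//; apply/andP; split; apply: ltW; near: x.
  exact: lt_nbhsr.
exact: lt_nbhsl.
Unshelve. all: end_near. Qed.

(** Translation by multiples of [P] brings every point to the open interval or to 0; only at 0 do
    two copies of [q] meet, and there [q 0 = q P] matches the one-sided limits. *)
Lemma periodic_extension P q : 0 < P -> {within `[0, P], continuous q} ->
  q 0 = q P -> exists Q, [/\ continuous Q, periodic Q P &
    forall t, 0 <= t <= P -> Q t = q t].
Proof.
move=> P0 cq q0P; have P00 : P != 0 by rewrite gt_eqF.
pose Q t := q (t - (Num.floor (t / P))%:~R * P).
have Qper t (n : int) : Q (t + n%:~R * P) = Q t.
  rewrite /Q mulrDl mulfK// floorDrz ?intr_int// intrKfloor intrD mulrDl.
  by congr q; ring.
have QP : periodic Q P by move=> t; have := Qper t 1; rewrite mul1r.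
have Qq t : 0 <= t < P -> Q t = q t.
  move=> /andP[t0 tP]; rewrite /Q (_ : Num.floor _ = 0) ?mul0r ?subr0//.
  by apply/eqP; rewrite floor_eq//= divr_ge0 ?(ltW P0)//= ltr_pdivrMr// mul1r.
have Qc t : 0 <= t <= P -> Q t = q t.
  move=> /andP[t0]; rewrite le_eqVlt => /predU1P[->|tP]; last by rewrite Qq ?t0.
  by rewrite (periodic0P QP) Qq ?lexx.
exists Q; split => //.
have [cin c0 cP] := (continuous_within_itvP q P0).1 cq.
have Q0 : {for 0, continuous Q}.
  apply/left_right_continuousP; split.
    have -> : Q 0 = q P by rewrite Qq ?lexx.
    apply/cvgrPdist_lt => e e0.
    have [d /= d0 H] := (cvgrPdist_lt _ _).1 cP e e0.
    near=> x; have x0 : x < 0 by near: x; exact: nbhs_left_lt.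
    have xP : - P < x by near: x; apply: nbhs_left_gt; rewrite oppr_lt0.
    have xd : - d < x by near: x; apply: nbhs_left_gt; rewrite oppr_lt0.
    rewrite -(QP x) Qc; last by apply/andP; split; lra.
    apply: H; last by lra.
    by rewrite /= opprD addrCA subrr addr0 normrN ltr_norml; apply/andP; split; lra.
  rewrite Qq ?lexx//; apply: cvg_trans c0; apply: near_eq_cvg; near=> x.
  rewrite Qq//; apply/andP; split; near: x; last exact: nbhs_right_lt.
  exact: nbhs_right_ge.
have Qin t : 0 < t < P -> {for t, continuous Q}.
  move=> /andP[t0 tP]; rewrite /prop_for /continuous_at Qq ?(ltW t0)//.
  have ct : {for t, continuous q} by apply: cin; rewrite in_itv/= t0.
  apply: cvg_trans ct; apply: near_eq_cvg; near=> x.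
  rewrite Qq//; apply/andP; split; [apply: ltW|]; near: x.
    exact: lt_nbhsr.
  exact: lt_nbhsl.
move=> t; pose n := Num.floor (t / P).
have /andP[n1 n2] := floor_itv (t / P).
rewrite ler_pdivlMr// in n1; rewrite ltr_pdivrMr// intrD mulrDl mul1r in n2.
have QE : Q = Q \o (fun x => x + (- n)%:~R * P).
  by apply/funext => x /=; rewrite Qper.
rewrite QE; apply: continuous_comp; first by apply: cvgD; [exact: cvg_id|exact: cvg_cst].
have [tn|tn] := eqVneq (t + (- n)%:~R * P) 0; first by rewrite tn.
apply: Qin; rewrite mulrNz mulNr in tn *; rewrite lt_def tn.
by apply/andP; split; rewrite -/n in n1 n2; lra.
Unshelve. all: end_near. Qed.

End WeakDerivatives.

(** * Regularity of weak solutions *)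

Section Regularity.
Context {R : realType}.
Implicit Types (gamma : R -> R * R) (f g k kappa phi : R -> R) (c t x P : R).

Local Notation mu := (@lebesgue_measure R).

Lemma cube_le (x y : R) : (x <= y) = (x ^+ 3 <= y ^+ 3).
Proof.
have lt_cube (a b : R) : a < b -> a ^+ 3 < b ^+ 3.
  move=> ab; rewrite -subr_gt0.
  have -> : b ^+ 3 - a ^+ 3 =
      (b - a) * (((a + b) ^+ 2 + (a ^+ 2 + b ^+ 2)) / 2) by field.
  rewrite mulr_gt0 ?subr_gt0// divr_gt0// ltr_wpDl ?sqr_ge0//.
  have := sqr_ge0 (a - b); have := sqr_ge0 a; have := sqr_ge0 b.
  rewrite !le_eqVlt => /predU1P[/esym/eqP b0|] ; last by move=> *; nra.
  rewrite sqrf_eq0 in b0; move/eqP: b0 => b0 _ _; rewrite b0 expr0n addr0.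
  by rewrite exprn_even_gt0//= lt_eqF// -b0.
apply/idP/idP; last by apply: contraTT; rewrite -!ltNge; exact: lt_cube.
by rewrite le_eqVlt => /predU1P[->//|/lt_cube/ltW].
Qed.

Lemma L1_measurable P f : segL1 P f -> measurable_fun `[0, P] f.
Proof. by move=> /(measurable_int mu)/measurable_EFinP. Qed.

Lemma L1_le P f g : measurable_fun `[0, P] f -> segL1 P g ->
  (forall t, `|f t| <= `|g t|) -> segL1 P f.
Proof.
move=> mf Lg fg; apply: (@le_integrable _ _ _ mu _ _ _ (EFin \o g)) => //.
  exact/measurable_EFinP.
by move=> t _; rewrite /= lee_fin.
Qed.

Lemma L1_of_L2 P f : L2 P f -> segL1 P f.
Proof.
move=> [mf f2]; have L2f : segL1 P (fun t => 1 + f t ^+ 2) by exact: L1D (L1_cst P 1) f2.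
apply: L1_le mf L2f _ => t; rewrite [leRHS]ger0_norm ?addr_ge0 ?sqr_ge0//.
rewrite -[f t ^+ 2]real_normK ?num_real//.
by have := sqr_ge0 (`|f t| - 1); have := normr_ge0 (f t); nra.
Qed.

(** [weak_solution] provides integrability of the cube alone. Cubing preserves and reflects the
    order, so measurability descends to [f], and [|f| <= 1 + |f|^3]. *)
Lemma L1_of_cube P f : segL1 P (fun t => f t ^+ 3) -> segL1 P f.
Proof.
move=> L3; have m3 := L1_measurable L3.
have mf : measurable_fun `[0, P] f.
  apply: (measurability (@RGenCInfty.G R)) => [|/= _ [_] [r] -> <-].
    exact: RGenCInfty.measurableE.
  rewrite (_ : f @^-1` `[r, +oo[ = (fun t => f t ^+ 3) @^-1` `[r ^+ 3, +oo[).
    by apply: m3.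
  by apply/seteqP; split => t /=; rewrite !in_itv/= !andbT -cube_le.
have L4 : segL1 P (fun t => 1 + `|f t ^+ 3|) by exact: L1D (L1_cst P 1) (L1_norm L3).
apply: L1_le mf L4 _ => t; rewrite [leRHS]ger0_norm ?addr_ge0// normrX.
have [f1|f1] := leP `|f t| 1; first by have := exprn_ge0 3 (normr_ge0 (f t)); lra.
have : `|f t| <= `|f t| ^+ 3 by rewrite ler_eXnr// ltW.
by lra.
Qed.

Lemma ae_and (A B : set R) : {ae mu, forall t, A t} -> {ae mu, forall t, B t} ->
  {ae mu, forall t, A t /\ B t}.
Proof.
by move=> a b; apply: filterS2 a b => //; exact: (ae_filter_ringOfSetsType mu).
Qed.

(* Testing the equation with primitives of zero-mean test functions shows that
   [kappa] has a weak derivative which is itself a primitive of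
   [1 - kappa^3 / 2]; so [kappa] is almost everywhere a classical solution. *)
Lemma weak_solution_regular P kappa : 0 < P -> weak_solution P kappa ->
  exists k k1, [/\ is_solution k k1, periodic k P, segL1 P kappa &
    {ae mu, forall t, 0 < t < P -> kappa t = k t}].
Proof.
move=> P0 [L3 wsol]; have Lk := L1_of_cube (L3 : segL1 P (fun t => kappa t ^+ 3)).
have P00 : P != 0 by rewrite gt_eqF.
have PP : 0 <= P <= P by rewrite lexx ltW.
pose q0 t := 1 - 2^-1 * kappa t ^+ 3.
have Lq0 : segL1 P q0 by exact: L1B (L1_cst P 1) (L1Z _ L3).
pose A1 := prim q0.
have eqn phi : smooth phi -> periodic phi P ->
    \int[mu]_(t in `[0, P]) (kappa t * derive1 (derive1 phi) t) =
    \int[mu]_(t in `[0, P]) (q0 t * phi t).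
  move=> sphi phiP; have cphi := smooth_cont sphi.
  have cd2 := smooth_cont (smooth_derive1 (smooth_derive1 sphi)).
  apply/esym/eqP; rewrite -subr_eq0 -(RintB (L1M Lq0 cphi) (L1M Lk cd2)).
  rewrite -[X in _ == X](wsol phi sphi phiP); apply/eqP; apply: eq_Rintegral => t _.
  by rewrite /q0 /derive1n /=; ring.
have A1P : A1 P = 0.
  have d1 : derive1 (fun _ : R => 1 : R) = cst 0.
    by apply/funext => t; rewrite derive1_cst.
  have := eqn _ (@smooth_cst R 1) (fun _ => erefl); rewrite d1.
  under eq_Rintegral do rewrite derive1_cst mulr0.
  under [RHS]eq_Rintegral do rewrite mulr1.
  by rewrite Rint_cst ?(ltW P0)// mul0r => /esym.
have LA1 : segL1 P A1 := prim_L1 (ltW P0) Lq0.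
(* A weak derivative on the circle has mean zero. The constant appears when a test function is
   replaced by its mean-zero part, and moving that mean onto [A1] subtracts [a1]. *)
pose a1 := (\int[mu]_(t in `[0, P]) A1 t) / P.
pose q t := A1 t - a1; have Lq : segL1 P q by exact: L1B LA1 (L1_cst P a1).
have wd : weak_derivative P kappa q.
  move=> psi spsi psiP; have cpsi := smooth_cont spsi.
  have Lpsi := cont_L1 P cpsi.
  pose b := (\int[mu]_(t in `[0, P]) psi t) / P.
  have s1 : smooth (fun t => psi t - b) by exact: smoothB_cst.
  have p1 : periodic (fun t => psi t - b) P by move=> t; rewrite psiP.
  have z1 : \int[mu]_(t in `[0, P]) (psi t - b) = 0.
    by rewrite (RintB Lpsi (L1_cst P b)) Rint_cst ?(ltW P0)// /b divfK ?subrr.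
  have [chi [schi pchi dchi _]] := test_primitive P0 s1 p1 z1.
  have := eqn chi schi pchi; rewrite (L1_by_parts P0 Lq0 schi) -/A1 A1P mul0r sub0r.
  rewrite dchi (_ : derive1 (fun t => psi t - b) = derive1 psi); last first.
    apply/funext => t; apply: is_derive_derive1.
    by have d := smooth_is_derive t spsi; der; ring.
  move=> ->; congr (- _).
  under eq_Rintegral do rewrite mulrBr (mulrC _ b).
  under [RHS]eq_Rintegral do rewrite mulrBl.
  rewrite (RintB (L1M LA1 cpsi) (L1Z b LA1)) (RintZ _ LA1).
  rewrite (RintB (L1M LA1 cpsi) (L1Z a1 Lpsi)) (RintZ _ Lpsi).
  by rewrite /a1 /b; ring.
have [qP [c kc]] := weak_derivative_prim P0 Lk Lq wd.
have Lpq : segL1 P (prim q) := prim_L1 (ltW P0) Lq.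
have Lcq : segL1 P (fun t => c + prim q t) by exact: L1D (L1_cst P c) Lpq.
have kae0 : {ae mu, forall t, 0 < t < P -> kappa t = c + prim q t}.
  have LB := L1B Lk Lcq.
  apply: (ae_imp (prim0_ae LB _)) => [t tP|t H /H]; last by lra.
  have /andP[t0 tP'] := tP.
  rewrite /prim (RintB (L1_sub Lk tP' : segL1 t kappa) (L1_sub Lcq tP' : segL1 t _)).
  by rewrite -/(prim kappa t) kc// subrr.
have cq : {within `[0, P], continuous q}.
  move=> x; apply: continuousB; last exact: cst_continuous.
  exact: (prim_continuous (ltW P0) Lq0).
have q0P : q 0 = q P by rewrite /q A1P /A1 prim0.
have [Q [cQ pQ Qq]] := periodic_extension P0 cq q0P.
have [K [K0 dK]] := ex_primitive cQ.
have KE t : 0 <= t <= P -> K t = prim q t.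
  move=> /andP[t0 tP]; rewrite -[K t]subr0 -K0 -(Rintegral_FTC2 t0 cQ dK).
  by apply: eq_prim => x /andP[x0 xt]; rewrite Qq// x0 (le_trans xt).
pose k t := c + K t.
have dk t : is_derive t 1 k (Q t) by rewrite /k; der; ring.
have ck : continuous k := is_derive_cont dk.
have kP : periodic k P.
  by move=> t; rewrite /k (primitive_periodic dK pQ) (KE _ PP) qP K0 subrr addr0.
have kae : {ae mu, forall t, 0 < t < P -> kappa t = k t}.
  apply: (ae_imp kae0) => t H /[dup] tP /H ->.
  by rewrite /k KE//; case/andP: tP => ? ?; rewrite !ltW.
(* Bootstrap: [kappa = k] almost everywhere, so [A1] is also the primitive of the continuous [w].
   Hence [Q], so far only continuous, is differentiable with derivative [w]. *)
pose w t := 1 - 2^-1 * k t ^+ 3.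
have cw : continuous w by rewrite /w; dercont.
have [V [V0 dV]] := ex_primitive cw.
have VE t : 0 <= t <= P -> V t = A1 t.
  move=> /[dup] tP /andP[t0 _].
  rewrite -[V t]subr0 -V0 -(Rintegral_FTC2 t0 cw dV).
  apply/esym; apply: (ae_prim_eq Lq0 (cont_L1 P cw)) tP.
  by apply: (ae_imp kae) => x H /H; rewrite /q0 /w => ->.
have wP : periodic w P by move=> t; rewrite /w kP.
have QV t : Q t = V t - a1.
  apply: (@periodic_eq _ Q (fun t => V t - a1) P P0 pQ) => [x|x xP].
    by rewrite (primitive_periodic dV wP) (VE _ PP) A1P V0 subrr addr0.
  by rewrite Qq// VE.
exists k, Q; split => // t; split; first exact: dk.
have -> : Q = (fun t => V t - a1) by apply/funext => x; exact: QV.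
by der; rewrite /w; ring.
Qed.

(** The two conclusions serve in turn: the first gives [u] a classical derivative almost everywhere,
    from which [g] can be computed at those points; once [g] is known to agree with a continuous
    [w], the second gives the derivative everywhere. *)
Lemma weak_derivative_continuous P u g w : 0 < P -> continuous u ->
  periodic u P -> segL1 P g -> weak_derivative P u g ->
  exists c, (forall t, 0 <= t <= P -> u t = c + prim g t) /\
  (continuous w -> periodic w P -> {ae mu, forall t, 0 < t < P -> g t = w t} ->
   forall t : R, is_derive t 1 u (w t)).
Proof.
move=> P0 cu uP Lg wd.
have PP : 0 <= P <= P by rewrite lexx ltW.
have [gP [c uc]] := weak_derivative_prim P0 (cont_L1 P cu) Lg wd.
have cg := prim_continuous (ltW P0) Lg.
have cc : {within `[0, P], continuous (fun t => c + prim g t)}.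
  by move=> x; apply: continuousD; [exact: cst_continuous|exact: cg].
have cuw : {within `[0, P], continuous u} := continuous_subspaceT cu.
have uE t : 0 <= t <= P -> u t = c + prim g t.
  have cd : {within `[0, P], continuous (fun t => u t - (c + prim g t))}.
    by move=> x; apply: cvgB; [exact: cuw|exact: cc].
  move=> tP; apply/eqP; rewrite -subr_eq0; apply/eqP.
  apply: (within_closed P0 cd _ tP) => x xP.
  by rewrite (prim_eq_interior cuw cc uc xP) subrr.
exists c; split => // cw wP gw.
have [U [U0 dU]] := ex_primitive cw.
have UE t : 0 <= t <= P -> U t = prim g t.
  move=> /[dup] tP /andP[t0 _].
  rewrite -[U t]subr0 -U0 -(Rintegral_FTC2 t0 cw dU).
  by apply/esym; exact: (ae_prim_eq Lg (cont_L1 P cw)) tP.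
have UP : periodic U P.
  by move=> t; rewrite (primitive_periodic dU wP) (UE _ PP) gP U0 subrr addr0.
have uU : u = (fun t => c + U t).
  apply/funext; apply: (@periodic_eq _ _ _ P) => // [x|t tP]; first by rewrite UP.
  by rewrite uE// UE.
by move=> t; rewrite uU; der; ring.
Qed.

(** At almost every point the tangent is differentiable and the curvature equals [k], so
    [arclength_frenet] computes the weak derivatives of the tangent there. Their continuous
    representatives give the Frenet equations everywhere, so the curvature equals [k] at every
    point. *)
Lemma curve_regular P gamma : W22Imm P gamma -> arclength gamma ->
  weak_solution P (curvature gamma) ->
  exists k k1 u v, [/\ framed gamma k u v, is_solution k k1 & periodic k P].
Proof.
move=> [P0 [xP dx cu [gu /L1_of_L2 Lgu wdu]] [yP dy cv [gv /L1_of_L2 Lgv wdv]] _] al.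
move=> ws; have [k [k1 [sol kP Lk kae]]] := weak_solution_regular P0 ws.
have dk t := (sol t).1; have ck := is_derive_cont dk.
pose u t := (dcurve gamma t).1; pose v t := (dcurve gamma t).2.
have uP : periodic u P := periodic_derive1 dx xP.
have vP : periodic v P := periodic_derive1 dy yP.
have cw1 : continuous (fun t => - (k t * v t)).
  by move=> t; apply: cvgN; apply: cvgM; [exact: ck|exact: cv].
have cw2 : continuous (fun t => k t * u t).
  by move=> t; apply: cvgM; [exact: ck|exact: cu].
have [cu0 [uE du]] := weak_derivative_continuous (fun t => - (k t * v t)) P0 cu uP Lgu wdu.
have [cv0 [vE dv]] := weak_derivative_continuous (fun t => k t * u t) P0 cv vP Lgv wdv.
have near_prim (f g : R -> R) c t : 0 < t < P ->
    (forall x, 0 <= x <= P -> f x = c + prim g x) ->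
    is_derive t 1 (prim g) (g t) -> is_derive t 1 f (g t).
  move=> /andP[t0 tP] fE dg.
  have d1 : is_derive t 1 (fun x => c + prim g x) (g t) by der; ring.
  apply: near_eq_is_derive d1; near=> x.
  rewrite fE//; apply/andP; split; apply: ltW; near: x.
    exact: lt_nbhsr.
  exact: lt_nbhsl.
have gae : {ae mu, forall t, 0 < t < P ->
    gu t = - (k t * v t) /\ gv t = k t * u t}.
  apply: (ae_imp (ae_and kae (ae_and (prim_derivable_ae Lgu) (prim_derivable_ae Lgv)))).
  move=> t [kE [ug vg]] tP.
  have [-> ->] := arclength_frenet al (near_prim _ _ _ _ tP uE (ug tP))
    (near_prim _ _ _ _ tP vE (vg tP)).
  by rewrite kE.
exists k, k1, u, v; split => // t; split.
- exact: derivable_is_derive.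
- exact: derivable_is_derive.
- apply: du => // [x|]; first by rewrite kP vP.
  by apply: (ae_imp gae) => x H /H[].
- apply: dv => // [x|]; first by rewrite kP uP.
  by apply: (ae_imp gae) => x H /H[].
- exact: dcurve_arclengthE.
Unshelve. all: end_near. Qed.

End Regularity.

Theorem lemma5p16 (R : realType) :
  (forall (L : R) (gamma : R -> R * R),
      W22Imm L gamma ->
      arclength gamma ->
      winding_number L gamma = 1 ->
      ~ is_circle gamma ->
      weak_solution L (curvature gamma) ->
      exists m : nat,
        [/\ (2 <= m)%N,
            has_m_periods m (curve_length L gamma) (curvature gamma) &
            energy_area_bounds m L gamma])
  /\
  (forall m : nat, (2 <= m)%N ->
      [/\ (exists (L : R) (kappa : R -> R) (gamma : R -> R * R),
              solution_with_curve m L kappa gamma),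
          (forall (L1 L2 : R) (kappa1 kappa2 : R -> R)
                  (gamma1 gamma2 : R -> R * R),
              solution_with_curve m L1 kappa1 gamma1 ->
              solution_with_curve m L2 kappa2 gamma2 ->
              exists a : R, forall t, kappa2 t = kappa1 (t + a)) &
          (forall (L : R) (kappa : R -> R) (gamma : R -> R * R),
              solution_with_curve m L kappa gamma ->
              energy_area_bounds m L gamma)]).
Proof.
split=> [L gamma W al wn nc ws|m m2]; last first.
  split; first exact: ex_solution_with_curve.
    by move=> L1 L2 k1 k2 g1 g2; exact: solution_with_curve_unique.
  by move=> L k g /(solution_with_curve_profile m2)[e [c []]].
have [k [k1 [u [v [F sol kP]]]]] := curve_regular W al ws.
have [L0 [xP _ _ _] [yP _ _ _] _] := W.
have gP : periodic gamma L.
  move=> t; have := xP t; have := yP t => /= h2 h1.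
  by rewrite [LHS]surjective_pairing [RHS]surjective_pairing h1 h2.
have kint := framed_total_curvature F wn.
have kn : ~ exists c, forall t, k t = c.
  by move=> [c kc]; apply: nc; exact: framed_cst_circle F sol kc.
have [m [e [c [[m2 e0 eT kmin kEp] kE2]]]] := closed_solution L0 kP sol kn kint.
exists m; split => //; last exact: framed_bounds L0 F sol gP kE2.
rewrite /has_m_periods /curve_length (framed_integral _ _ F) (framed_curvature F).
by rewrite Rint_cst ?(ltW L0)// mul1r.
Qed.
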